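(* Let $A$ and $C$ be positive real constants. The metric entropy of the class $\mathcal{F}_{\mathrm{exp}}^{A,C}$ equipped with the metric $d_1$ satisfies $$\left(\frac{eA}{2}\right)^2\frac{\exp\{2\beta_1(\varepsilon)\}}{\ln(2)}\left[\beta_1(\varepsilon)+\frac12\right]\left[1+O_{\beta_1(\varepsilon)\to\infty}\left(\exp\{-\beta_1(\varepsilon)\}\right)\right]\le H\left(\varepsilon;\mathcal{F}_{\mathrm{exp}}^{A,C},d_1\right)$$ and $$H\left(\varepsilon;\mathcal{F}_{\mathrm{exp}}^{A,C},d_1\right)\le(eA)^2\,\frac{\exp\{2\beta_2(\varepsilon)\}}{\ln(2)}\left[\beta_2(\varepsilon)+\frac12\right]\left[1+O_{\beta_2(\varepsilon)\to\infty}\left(\exp\{-\beta_2(\varepsilon)\}\right)\right],$$ where $$\beta_1(\varepsilon)=W\left(\frac{2\ln(\varepsilon^{-1})}{eA}\right)\quad\text{and}\quad\beta_2(\varepsilon)=W\left(\frac{\ln(\varepsilon^{-1})}{eA}\right),$$ with $W$ denoting the Lambert $W$-function.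
   Context: $\ln$ is the natural logarithm. The Lambert $W$-function is the unique function with $W(x)e^{W(x)}=x$ for all $x\ge0$. $\mathcal{F}_{\mathrm{exp}}^{A,C}$ is the class of entire functions $f$ such that $|f(z)|\le Ce^{A|z|}$ for all $z\in\mathbb{C}$. The metric is $d_1(f_1,f_2)=\sup_{z\in D(0;1)}|f_1(z)-f_2(z)|$, where $D(0;1)$ is the open unit disk in $\mathbb{C}$. Metric entropy: for a subset $\mathcal{K}$ of a metric space $(\mathcal{X},d)$, an $\varepsilon$-covering is a set $\{x_1,\dots,x_N\}\subseteq\mathcal{X}$ such that every $x\in\mathcal{K}$ has some $i$ with $d(x,x_i)\le\varepsilon$; $N(\varepsilon;\mathcal{K},d)$ is the cardinality of a smallest $\varepsilon$-covering and $H(\varepsilon;\mathcal{K},d)=\log_2N(\varepsilon;\mathcal{K},d)$. Here the ambient space $\mathcal{X}$ is the space of bounded analytic functions on $D(0;1)$ with the metric $d_1$. The statement is asymptotic as $\varepsilon\to0$ (so $\beta_1(\varepsilon),\beta_2(\varepsilon)\to\infty$): each $O_{\beta_i(\varepsilon)\to\infty}(\exp\{-\beta_i(\varepsilon)\})$ stands for some function of $\varepsilon$ bounded in absolute value by a constant (independent of $\varepsilon$) times $\exp\{-\beta_i(\varepsilon)\}$ for all sufficiently small $\varepsilon>0$. *)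

(* Defs.v *)
From Stdlib Require Import Reals Lra List ClassicalEpsilon.
From Coquelicot Require Import Coquelicot.
Open Scope R_scope.

(** * Lambert W-function *)

Definition lambertW (x : R) : R :=
  epsilon (inhabits 0) (fun w => w * exp w = x).

Lemma lambertW_spec (x : R) : 0 <= x -> lambertW x * exp (lambertW x) = x.
Proof.
intros Hx; unfold lambertW; apply epsilon_spec.
destruct (IVT_cor (fun w => w * exp w - x) 0 x) as [w [_ Hw]].
- apply continuity_minus; [| apply continuity_const; now intros ? ?].
  apply continuity_mult; apply derivable_continuous.
  + apply derivable_id.
  + apply derivable_exp.
- exact Hx.
- assert (H := exp_ineq1_le x).
  assert (0 <= x * x * (exp x - 1)) by (repeat apply Rmult_le_pos; lra).
  lra.
- exists w; lra.
Qed.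

(* Hence the equation determines [lambertW x] for every [x >= 0]. *)
Lemma lambertW_unique (x w : R) : 0 <= x -> w * exp w = x -> w = lambertW x.
Proof.
intros Hx Hw; assert (HW := lambertW_spec x Hx); revert HW.
generalize (lambertW x) as v; intros v Hv.
assert (Pw := exp_pos w); assert (Pv := exp_pos v).
assert (w0 : 0 <= w) by nra; assert (v0 : 0 <= v) by nra.
destruct (Rtotal_order w v) as [H | [H | H]]; [| exact H |];
  apply exp_increasing in H as H'; exfalso; nra.
Qed.

(** * Metric entropy *)

(* [ambient] singles out the points of the metric space inside the carrier
   type [X]: the centres of a covering must satisfy it. *)
Definition is_covering {X : Type} (ambient : X -> Prop) (d : X -> X -> R)
    (K : X -> Prop) (eps : R) (s : list X) : Prop :=
  (forall y, In y s -> ambient y) /\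
  (forall x, K x -> exists y, In y s /\ d x y <= eps).

(* If a finite covering exists, this is the infimum of a nonempty set of
   natural numbers, i.e. the least length of a covering (a covering of least
   length has no redundant entries); otherwise it is [p_infty]. *)
Definition covering_number {X : Type} (ambient : X -> Prop) (d : X -> X -> R)
    (K : X -> Prop) (eps : R) : Rbar :=
  Glb_Rbar (fun r => exists s, is_covering ambient d K eps s /\
                               r = INR (length s)).

Definition Rbar_log2 (x : Rbar) : Rbar :=
  match x with
  | Finite r => Finite (ln r / ln 2)
  | _ => x
  end.

Definition metric_entropy {X : Type} (ambient : X -> Prop) (d : X -> X -> R)
    (K : X -> Prop) (eps : R) : Rbar :=
  Rbar_log2 (covering_number ambient d K eps).

(** * Function classes *)

Definition holomorphic_on (D : C -> Prop) (f : C -> C) : Prop :=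
  forall z, D z -> @ex_derive C_AbsRing C_NormedModule f z.

Definition entire (f : C -> C) : Prop := holomorphic_on (fun _ => True) f.

Definition unit_disk (z : C) : Prop := Cmod z < 1.

(* Functions on the disk are represented by total functions [C -> C] whose
   values outside the disk are irrelevant: [d1] does not see them. *)
Definition bounded_analytic_on_disk (f : C -> C) : Prop :=
  holomorphic_on unit_disk f /\
  exists M : R, forall z, unit_disk z -> Cmod (f z) <= M.

(* On bounded functions the least upper bound is finite, so [real] is
   harmless. *)
Definition d1 (f g : C -> C) : R :=
  real (Lub_Rbar (fun r => exists z, unit_disk z /\ r = Cmod (f z - g z)%C)).

Definition F_exp (A B : R) (f : C -> C) : Prop :=
  entire f /\ forall z : C, Cmod (f z) <= B * exp (A * Cmod z).

Definition entropy_F_exp (A B eps : R) : Rbar :=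
  metric_entropy bounded_analytic_on_disk d1 (F_exp A B) eps.

(** * Asymptotic terms *)

Definition big_O_at_0 (r g : R -> R) : Prop :=
  exists M : R, at_right 0 (fun eps => Rabs (r eps) <= M * g eps).

Definition beta1 (A eps : R) : R := lambertW (2 * ln (/ eps) / (exp 1 * A)).
Definition beta2 (A eps : R) : R := lambertW (ln (/ eps) / (exp 1 * A)).

(* Main.v *)
Require Import Defs.
From Stdlib Require Import ZArith Reals Arith Lra Lia List ClassicalEpsilon Classical FinFun FunctionalExtensionality.
From Coquelicot Require Import Coquelicot.
Open Scope R_scope.

(** The entropy is read off from Taylor coefficients.  Let [f] be in
    [F_exp A B] with Taylor coefficients [a_n].  Cauchy's estimate on the
    circle of radius [n / A], where [exp (A r) / r ^ n] is smallest, gives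
    [|a_n| <= B (e A / n) ^ n] for [n >= 1] and, taken at [n = N], the same
    order of magnitude for the tail [f - sum_(n < N) a_n z ^ n] on the unit
    disk ([F_exp_coef_bound], [F_exp_tail]).  In terms of
    [phi A n = n (ln (n / A) - 1)] these are multiples of
    [exp (- phi A n)].  Conversely, polynomials of degree less than [N] with
    [|a_n| <= (B / N) exp (- phi A n)] belong to the class
    ([psum_in_F_exp]).

    So the class is, up to factors polynomial in [N], a product of disks of
    radii [exp (- phi A n)], of which only the [x] first are larger than
    [eps], where [phi A x = ln (1 / eps)]; with [x = A exp (b + 1)] this
    equation reads [x b = ln (1 / eps)], that is, [b] is the Lambert value
    [beta2 A eps].  Rounding each coefficient to a square grid gives a
    covering ([covering_upper]).  Grid polynomials whose coefficients are
    [3 eps] apart are [3 eps] apart for the distance, since a coefficient is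
    bounded by the supremum over the disk; no centre serves two of them,
    which bounds every covering from below ([covering_lower]).  Both
    logarithms equal
    [2 sum_(n < N) (ln (1 / eps) - phi A n)] with [N] within [2] of [x], up to
    an error [O (N ln N)].  The sum is compared with the integral of the
    summand, [x ^ 2 (b / 2 + 1 / 4)] ([rsum_phi], [Legendre_Phi_le],
    [Legendre_Phi_ge]), again within [O (N ln N) = O (x b)].  Relative to
    the main term [x ^ 2 (b + 1 / 2)] this error is [O (1 / x)], which is
    [O (exp (- b))].

    Hence [x ^ 2 (b + 1 / 2) / ln 2] is the exact asymptotics of the entropy
    of [F_exp A B], and it is the stated upper bound.  The stated lower bound
    is the same asymptotics for the subclass [F_exp (A / 2) B], as
    [beta1 A = beta2 (A / 2)].

    The analytic input is that a function which is merely complex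
    differentiable everywhere has these Taylor coefficients.  For [z] inside
    the circle of radius [r], the disk is parametrized as a cone with apex
    [z]; Goursat's bisection of parameter rectangles shows that the
    difference quotient of [f] at [z] has integral zero over the circle
    ([circle_integral_vanishes]).  This is Cauchy's formula, and the
    truncated geometric series turns it into the Taylor expansion with an
    explicit remainder ([taylor_remainder]). *)

(** * Integrals of complex-valued functions of a real variable *)

(** The plane carries the product topology here, so that continuity can be
    checked componentwise. *)
Notation Ccts := (@continuous R_UniformSpace C_UniformSpace).

(** Integrating the two components separately reduces linearity, Chasles
    and the fundamental theorem to the real Riemann integral. *)
Definition Cint (f : R -> C) (a b : R) : C :=
  (RInt (fun t => Re (f t)) a b, RInt (fun t => Im (f t)) a b).

Lemma C_eq (z w : C) : Re z = Re w -> Im z = Im w -> z = w.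
Proof. destruct z, w; simpl; congruence. Qed.

Lemma Ccts_pair (f : R -> C) x :
  continuous (fun t => Re (f t)) x -> continuous (fun t => Im (f t)) x -> Ccts f x.
Proof.
intros H1 H2.
apply (continuous_ext (fun t => (Re (f t), Im (f t)) : C)).
  intros t; now destruct (f t).
apply (continuous_comp_2 (fun t => Re (f t)) (fun t => Im (f t)) (fun u v => (u, v) : C) x); auto.
apply continuous_ext with (f := fun z => z). now intros [].
apply continuous_id.
Qed.

Lemma Ccts_Re (f : R -> C) x : Ccts f x -> continuous (fun t => Re (f t)) x.
Proof. intros H; apply (continuous_comp f (fun z : C => Re z)); auto; apply continuous_fst. Qed.

Lemma Ccts_Im (f : R -> C) x : Ccts f x -> continuous (fun t => Im (f t)) x.
Proof. intros H; apply (continuous_comp f (fun z : C => Im z)); auto; apply continuous_snd. Qed.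

Lemma Ccts_mult (f g : R -> C) x : Ccts f x -> Ccts g x -> Ccts (fun t => (f t * g t)%C) x.
Proof.
intros Hf Hg.
apply Ccts_pair; simpl.
- apply (continuous_minus (V := R_NormedModule)); apply (continuous_mult (K := R_AbsRing)); now (apply Ccts_Re || apply Ccts_Im).
- apply (continuous_plus (V := R_NormedModule)); apply (continuous_mult (K := R_AbsRing)); now (apply Ccts_Re || apply Ccts_Im).
Qed.

Lemma Ccts_plus (f g : R -> C) x : Ccts f x -> Ccts g x -> Ccts (fun t => (f t + g t)%C) x.
Proof.
intros Hf Hg.
apply Ccts_pair; simpl; apply (continuous_plus (V := R_NormedModule)); now (apply Ccts_Re || apply Ccts_Im).
Qed.

Lemma Ccts_const (c : C) x : Ccts (fun _ => c) x.
Proof. apply continuous_const. Qed.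

Definition Ccts_on (f : R -> C) (a b : R) := forall x, a <= x <= b -> Ccts f x.

Lemma Ccts_ex_Re f a b : a <= b -> Ccts_on f a b -> ex_RInt (fun t => Re (f t)) a b.
Proof.
intros ab Hf; apply (ex_RInt_continuous (V := R_CompleteNormedModule)).
rewrite Rmin_left, Rmax_right by lra; intros; now apply Ccts_Re, Hf.
Qed.

Lemma Ccts_ex_Im f a b : a <= b -> Ccts_on f a b -> ex_RInt (fun t => Im (f t)) a b.
Proof.
intros ab Hf; apply (ex_RInt_continuous (V := R_CompleteNormedModule)).
rewrite Rmin_left, Rmax_right by lra; intros; now apply Ccts_Im, Hf.
Qed.

Lemma Cint_ext f g a b : a <= b -> (forall x, a <= x <= b -> f x = g x) -> Cint f a b = Cint g a b.
Proof.
intros ab H; unfold Cint; f_equal; apply RInt_ext; rewrite Rmin_left, Rmax_right by lra;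
intros x Hx; rewrite H; auto; lra.
Qed.

Lemma Cint_plus f g a b : a <= b -> Ccts_on f a b -> Ccts_on g a b ->
  Cint (fun t => f t + g t)%C a b = (Cint f a b + Cint g a b)%C.
Proof.
intros ab Hf Hg; unfold Cint, Cplus; simpl; f_equal.
- apply (RInt_plus (V := R_CompleteNormedModule)); now apply Ccts_ex_Re.
- apply (RInt_plus (V := R_CompleteNormedModule)); now apply Ccts_ex_Im.
Qed.

Lemma Cint_scal (c : C) f a b : a <= b -> Ccts_on f a b ->
  Cint (fun t => c * f t)%C a b = (c * Cint f a b)%C.
Proof.
intros ab Hf.
assert (H1 := Ccts_ex_Re f a b ab Hf); assert (H2 := Ccts_ex_Im f a b ab Hf).
unfold Cint, Cmult; simpl; f_equal.
- rewrite (RInt_minus (V := R_CompleteNormedModule) (fun t => fst c * Re (f t)) (fun t => snd c * Im (f t)));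
   try (now apply (ex_RInt_scal (V := R_NormedModule))).
  unfold minus, plus, opp; simpl.
  rewrite !(RInt_scal (V := R_CompleteNormedModule)); auto.
- rewrite (RInt_plus (V := R_CompleteNormedModule) (fun t => fst c * Im (f t)) (fun t => snd c * Re (f t)));
   try (now apply (ex_RInt_scal (V := R_NormedModule))).
  unfold minus, plus, opp; simpl.
  rewrite !(RInt_scal (V := R_CompleteNormedModule)); auto.
Qed.

Lemma Cint_Chasles f a b c : a <= b <= c -> Ccts_on f a c ->
  Cint f a c = (Cint f a b + Cint f b c)%C.
Proof.
intros [ab bc] Hf.
assert (H1 : Ccts_on f a b) by (intros x Hx; apply Hf; lra).
assert (H2 : Ccts_on f b c) by (intros x Hx; apply Hf; lra).
apply C_eq; symmetry.
- apply (RInt_Chasles (V := R_CompleteNormedModule) (fun t => Re (f t))); now apply Ccts_ex_Re.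
- apply (RInt_Chasles (V := R_CompleteNormedModule) (fun t => Im (f t))); now apply Ccts_ex_Im.
Qed.

(** Bounding the components separately would lose a factor; the sharp
    constant comes from viewing the integral as one with values in a normed
    space. *)
Lemma Cint_bound f a b M : a <= b -> Ccts_on f a b ->
  (forall x, a <= x <= b -> Cmod (f x) <= M) -> Cmod (Cint f a b) <= M * (b - a).
Proof.
intros ab Hf HM; rewrite Cmod_norm.
apply (norm_RInt_le (V := prod_NormedModule R_AbsRing R_NormedModule R_NormedModule) f (fun _ => M) a b); auto.
- intros x Hx; rewrite <- Cmod_norm; now apply HM.
- unfold Cint; apply (is_RInt_fct_extend_pair (U := R_NormedModule) (V := R_NormedModule)).
  + apply (RInt_correct (V := R_CompleteNormedModule)); now apply Ccts_ex_Re.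
  + apply (RInt_correct (V := R_CompleteNormedModule)); now apply Ccts_ex_Im.
- replace (M * (b - a)) with (scal (b - a) M); [apply (is_RInt_const (V := R_NormedModule)) |].
  unfold scal; simpl; unfold mult; simpl; ring.
Qed.

(** Derivative of a curve in the plane, by components. *)
Definition Cderiv (F : R -> C) (t : R) (l : C) :=
  is_derive (fun s => Re (F s)) t (Re l) /\ is_derive (fun s => Im (F s)) t (Im l).

Lemma Cint_FTC F f a b : a <= b -> Ccts_on f a b ->
  (forall x, a <= x <= b -> Cderiv F x (f x)) -> Cint f a b = (F b - F a)%C.
Proof.
intros ab Hf HF; unfold Cint.
apply C_eq; simpl; apply is_RInt_unique.
- apply (is_RInt_derive (V := R_CompleteNormedModule) (fun s => Re (F s)) (fun s => Re (f s)));
  rewrite Rmin_left, Rmax_right by lra; intros x Hx; [apply HF | apply Ccts_Re, Hf]; auto.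
- apply (is_RInt_derive (V := R_CompleteNormedModule) (fun s => Im (F s)) (fun s => Im (f s)));
  rewrite Rmin_left, Rmax_right by lra; intros x Hx; [apply HF | apply Ccts_Im, Hf]; auto.
Qed.

Lemma Cderiv_cts F t l : Cderiv F t l -> Ccts F t.
Proof.
intros [H1 H2]; apply Ccts_pair; apply (ex_derive_continuous (V := R_NormedModule)); eexists; eassumption.
Qed.

Lemma Cderiv_mult F G t l m : Cderiv F t l -> Cderiv G t m ->
  Cderiv (fun s => F s * G s)%C t (l * G t + F t * m)%C.
Proof.
intros [H1 H2] [H3 H4]; split; simpl.
- replace (fst l * fst (G t) - snd l * snd (G t) + (fst (F t) * fst m - snd (F t) * snd m))
    with ((Re l * Re (G t) + Re (F t) * Re m) - (Im l * Im (G t) + Im (F t) * Im m))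
    by (unfold Re, Im; ring).
  apply (is_derive_minus (V := R_NormedModule)); apply (is_derive_mult (K := R_AbsRing)); auto; intros; apply Rmult_comm.
- replace (fst l * snd (G t) + snd l * fst (G t) + (fst (F t) * snd m + snd (F t) * fst m))
    with ((Re l * Im (G t) + Re (F t) * Im m) + (Im l * Re (G t) + Im (F t) * Re m))
    by (unfold Re, Im; ring).
  apply (is_derive_plus (V := R_NormedModule)); apply (is_derive_mult (K := R_AbsRing)); auto; intros; apply Rmult_comm.
Qed.

Lemma Cderiv_plus F G t l m : Cderiv F t l -> Cderiv G t m ->
  Cderiv (fun s => F s + G s)%C t (l + m)%C.
Proof.
intros [H1 H2] [H3 H4]; split; simpl; now apply (is_derive_plus (V := R_NormedModule)).
Qed.

Lemma Cderiv_const c t : Cderiv (fun _ => c) t 0%C.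
Proof. split; simpl; apply (is_derive_const (V := R_NormedModule)). Qed.

Lemma Ccts_eps (f : R -> C) x : Ccts f x <->
  forall eta, 0 < eta -> exists d, 0 < d /\ forall t, Rabs (t - x) < d -> Cmod (f t - f x) < eta.
Proof.
split.
- intros Hf eta Heta.
  assert (Hr : 0 < eta / 2) by lra.
  destruct (Hf (fun z => Cmod (z - f x) < eta)) as [d Hd].
  + exists (mkposreal _ Hr); intros z [H1 H2].
    eapply Rle_lt_trans; [apply Cmod_2Rmax |].
    assert (H : Rmax (Rabs (fst (z - f x)%C)) (Rabs (snd (z - f x)%C)) < eta / 2) by
     (apply Rmax_lub_lt; [exact H1 | exact H2]).
    assert (sqrt 2 < 2) by (rewrite <- (sqrt_pow2 2) at 2 by lra; apply sqrt_lt_1; lra).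
    assert (0 < sqrt 2) by (apply sqrt_lt_R0; lra). 
    assert (0 <= Rmax (Rabs (fst (z - f x)%C)) (Rabs (snd (z - f x)%C))) by
     (eapply Rle_trans; [apply Rabs_pos | apply Rmax_l]). nra.
  + exists d; split; [apply cond_pos |]; intros t Ht; apply (Hd t); exact Ht.
- intros H P [e He].
  destruct (H e (cond_pos e)) as [d [Hd1 Hd2]].
  exists (mkposreal d Hd1); intros t Ht; apply He.
  assert (H' := Hd2 t Ht).
  split; (eapply Rle_lt_trans; [| exact H']).
  + eapply Rle_trans; [| apply Rmax_Cmod]; apply Rmax_l.
  + eapply Rle_trans; [| apply Rmax_Cmod]; apply Rmax_r.
Qed.

(** * Complex differentiability *)

(** Complex derivative in the form [f w = f z + l (w - z) + o (w - z)], which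
    is the local estimate that the bisection argument consumes. *)
Definition Cdiff (f : C -> C) (z l : C) := forall eta, 0 < eta -> exists d, 0 < d /\
  forall w, Cmod (w - z) < d -> Cmod (f w - f z - l * (w - z)) <= eta * Cmod (w - z).

(** The two sides differ only in the order of factors and in the
    presentation of neighbourhoods. *)
Lemma Cdiff_iff f z l : Cdiff f z l <-> @is_derive C_AbsRing C_NormedModule f z l.
Proof.
split.
- intros H; split; [apply is_linear_scal_l |].
  intros x Hx; apply (is_filter_lim_locally_unique (V := AbsRing_NormedModule C_AbsRing)) in Hx; subst x.
  intros e; destruct (H e (cond_pos e)) as [d [Hd Hw]].
  exists (mkposreal d Hd); intros w Bw.
  generalize (Hw w Bw); unfold minus, plus, opp, scal; simpl; unfold mult; simpl.
  intros K.
  replace (f w + - f z + - ((w + - z) * l))%C with (f w - f z - l * (w - z))%C by ring.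
  exact K.
- intros [_ H] eta Heta.
  destruct (H z (fun P HP => HP) (mkposreal eta Heta)) as [d Hd].
  exists d; split; [apply cond_pos |]; intros w Hw.
  generalize (Hd w Hw); unfold minus, plus, opp, scal; simpl; unfold mult; simpl.
  intros K.
  replace (f w - f z - l * (w - z))%C with (f w + - f z + - ((w + - z) * l))%C by ring.
  exact K.
Qed.

Lemma Cdiff_lipschitz f z l : Cdiff f z l -> exists d, 0 < d /\
  forall w, Cmod (w - z) < d -> Cmod (f w - f z) <= (1 + Cmod l) * Cmod (w - z).
Proof.
intros H; destruct (H 1 Rlt_0_1) as [d [Hd Hw]]; exists d; split; auto.
intros w Bw; specialize (Hw w Bw).
replace (f w - f z)%C with ((f w - f z - l * (w - z)) + l * (w - z))%C by ring.
eapply Rle_trans; [apply Cmod_triangle |]; rewrite Cmod_mult; lra.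
Qed.

Lemma Ccts_comp_diff f l (g : R -> C) t : Cdiff f (g t) l -> Ccts g t -> Ccts (fun s => f (g s)) t.
Proof.
intros Hf Hg; apply Ccts_eps; intros eta Heta.
destruct (Cdiff_lipschitz _ _ _ Hf) as [d [Hd Hw]].
assert (Hl := Cmod_ge_0 l).
assert (He : 0 < Rmin d (eta / (1 + Cmod l))).
{ apply Rmin_pos; auto; apply Rdiv_lt_0_compat; lra. }
destruct (proj1 (Ccts_eps g t) Hg _ He) as [e [He1 He2]].
exists e; split; auto; intros s Hs; specialize (He2 s Hs).
assert (H1 : Cmod (g s - g t) < d) by (eapply Rlt_le_trans; [exact He2 | apply Rmin_l]).
assert (H2 : Cmod (g s - g t) < eta / (1 + Cmod l)) by (eapply Rlt_le_trans; [exact He2 | apply Rmin_r]).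
eapply Rle_lt_trans; [now apply Hw |].
apply (Rmult_lt_compat_l (1 + Cmod l)) in H2; [| lra].
replace ((1 + Cmod l) * (eta / (1 + Cmod l))) with eta in H2 by (field; lra). exact H2.
Qed.

Lemma Cdiff_const c z : Cdiff (fun _ => c) z 0.
Proof.
intros eta He; exists 1; split; [lra |]; intros w _.
replace (c - c - 0 * (w - z))%C with (RtoC 0) by ring.
rewrite Cmod_0; apply Rmult_le_pos; [lra | apply Cmod_ge_0].
Qed.

Lemma Cdiff_id z : Cdiff (fun w => w) z 1.
Proof.
intros eta He; exists 1; split; [lra |]; intros w _.
replace (w - z - 1 * (w - z))%C with (RtoC 0) by ring.
rewrite Cmod_0; apply Rmult_le_pos; [lra | apply Cmod_ge_0].
Qed.

Lemma Cdiff_plus f g z l m : Cdiff f z l -> Cdiff g z m -> Cdiff (fun w => f w + g w)%C z (l + m)%C.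
Proof.
intros Hf Hg eta He.
destruct (Hf (eta / 2)) as [d [Hd Hd']]; [lra |].
destruct (Hg (eta / 2)) as [e [He1 He']]; [lra |].
exists (Rmin d e); split; [now apply Rmin_pos |]; intros w Hw.
specialize (Hd' w (Rlt_le_trans _ _ _ Hw (Rmin_l _ _))).
specialize (He' w (Rlt_le_trans _ _ _ Hw (Rmin_r _ _))).
replace (f w + g w - (f z + g z) - (l + m) * (w - z))%C with
  ((f w - f z - l * (w - z)) + (g w - g z - m * (w - z)))%C by ring.
eapply Rle_trans; [apply Cmod_triangle |]; lra.
Qed.

Lemma Cdiff_mult f g z l m : Cdiff f z l -> Cdiff g z m ->
  Cdiff (fun w => f w * g w)%C z (l * g z + f z * m)%C.
Proof.
intros Hf Hg eta He.
assert (Pf := Cmod_ge_0 (f z)); assert (Pg := Cmod_ge_0 (g z)).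
assert (Pl := Cmod_ge_0 l); assert (Pm := Cmod_ge_0 m).
destruct (Cdiff_lipschitz _ _ _ Hf) as [d1 [Hd1 Lf]].
destruct (Cdiff_lipschitz _ _ _ Hg) as [d2 [Hd2 Lg]].
set (S := Cmod (f z) + Cmod (g z) + 1); assert (HS : 0 < S) by (unfold S; lra).
assert (Hr : 0 < eta / 2 / S) by (apply Rdiv_lt_0_compat; lra).
destruct (Hf _ Hr) as [d3 [Hd3 Df]]; destruct (Hg _ Hr) as [d4 [Hd4 Dg]].
set (K := (1 + Cmod l) * (1 + Cmod m)); assert (HK : 0 < K) by (unfold K; nra).
assert (Hk : 0 < eta / 2 / K) by (apply Rdiv_lt_0_compat; lra).
exists (Rmin (Rmin d1 d2) (Rmin (Rmin d3 d4) (eta / 2 / K))).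
split; [repeat apply Rmin_pos; auto |]; intros w Hw.
apply Rmin_Rgt in Hw as [Hw1 Hw2]; apply Rmin_Rgt in Hw1 as [Hw11 Hw12].
apply Rmin_Rgt in Hw2 as [Hw2 Hw5]; apply Rmin_Rgt in Hw2 as [Hw3 Hw4].
specialize (Lf w Hw11); specialize (Lg w Hw12); specialize (Df w Hw3); specialize (Dg w Hw4).
replace (f w * g w - f z * g z - (l * g z + f z * m) * (w - z))%C with
  ((f w - f z - l * (w - z)) * g z + f z * (g w - g z - m * (w - z)) + (f w - f z) * (g w - g z))%C by ring.
eapply Rle_trans; [apply Cmod_triangle |].
eapply Rle_trans; [apply Rplus_le_compat_r, Cmod_triangle |].
rewrite !Cmod_mult.
set (h := Cmod (w - z)) in *; assert (Ph : 0 <= h) by apply Cmod_ge_0.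
assert (B1 : Cmod (f w - f z - l * (w - z)) * Cmod (g z) + Cmod (f z) * Cmod (g w - g z - m * (w - z))
   <= eta / 2 * h).
{ apply Rle_trans with (eta / 2 / S * h * (Cmod (g z) + Cmod (f z))); [nra |].
  replace (eta / 2 * h) with (eta / 2 / S * h * S) by (field; lra).
  apply Rmult_le_compat_l; [apply Rmult_le_pos; lra | unfold S; lra]. }
assert (B2 : Cmod (f w - f z) * Cmod (g w - g z) <= eta / 2 * h).
{ apply Rle_trans with (((1 + Cmod l) * h) * ((1 + Cmod m) * h)).
  - apply Rmult_le_compat; auto using Cmod_ge_0.
  - replace ((1 + Cmod l) * h * ((1 + Cmod m) * h)) with (K * h * h) by (unfold K; ring).
    apply Rmult_le_compat_r; auto.
    apply (Rmult_lt_compat_l K) in Hw5; [| lra].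
    replace (K * (eta / 2 / K)) with (eta / 2) in Hw5 by (field; lra). now apply Rlt_le. }
lra.
Qed.

Lemma Cdiff_inv (z : C) : z <> 0%C -> Cdiff (fun w => / w)%C z (- / (z * z))%C.
Proof.
intros Hz eta He.
assert (Pz := proj1 (Cmod_gt_0 z) Hz); set (r := Cmod z) in *.
assert (Hr : 0 < eta * r ^ 3 / 2) by (assert (0 < r ^ 3) by (now apply pow_lt); nra).
exists (Rmin (r / 2) (eta * r ^ 3 / 2)); split; [apply Rmin_pos; lra |]; intros w Hw.
apply Rmin_Rgt in Hw as [Hw1 Hw2].
assert (Hrw : r / 2 <= Cmod w).
{ assert (H := Cmod_triangle w (z - w)%C).
  replace (w + (z - w))%C with z in H by ring.
  replace (z - w)%C with (- (w - z))%C in H by ring.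
  rewrite Cmod_opp in H; fold r in H; lra. }
assert (Hw0 : w <> 0%C) by (apply Cmod_gt_0; lra).
replace (/ w - / z - - / (z * z) * (w - z))%C with ((w - z) * (w - z) / (z * z * w))%C by (field; auto).
rewrite Cmod_div by (repeat apply Cmult_neq_0; auto).
rewrite !Cmod_mult; fold r; set (h := Cmod (w - z)) in *.
assert (Ph : 0 <= h) by apply Cmod_ge_0.
assert (0 < r * r * Cmod w) by (repeat apply Rmult_lt_0_compat; lra).
apply Rle_div_l; auto.
rewrite (Rmult_comm eta h), Rmult_assoc.
apply Rmult_le_compat_l; auto.
apply Rle_trans with (eta * r ^ 3 / 2); [lra |].
replace (eta * r ^ 3 / 2) with (eta * (r * r * (r / 2))) by field.
apply Rmult_le_compat_l; [lra |]; apply Rmult_le_compat_l; [nra | auto].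
Qed.

(** * Bisection of rectangles *)

(** A rectangle [[x, x + h p] * [y, y + h q]] is encoded by its corner and a
    scale [h], since bisection keeps the aspect ratio; scale [0] is a point. *)
Definition nested (x0 y0 p q x y h : R) : Prop :=
  x0 <= x /\ x + h * p <= x0 + p /\ y0 <= y /\ y + h * q <= y0 + q.

(** Goursat's bisection for an abstract rectangle function.  If the value at
    scale [1] were some [c > 0], subadditivity would let one of the four
    quarters keep at least a quarter of it, and iterating would give nested
    rectangles of scale [h] with value at least [c h ^ 2].  They shrink to a
    point, at which this contradicts the smallness hypothesis. *)
Lemma bisection (m : R -> R -> R -> R) (x0 y0 p q : R) (hp : 0 < p) (hq : 0 < q)
  (subadd : forall x y h, 0 < h -> nested x0 y0 p q x y h ->
    m x y h <= m x y (h / 2) + m (x + h / 2 * p) y (h / 2)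
       + m x (y + h / 2 * q) (h / 2) + m (x + h / 2 * p) (y + h / 2 * q) (h / 2))
  (small : forall u v eta, 0 < eta -> nested x0 y0 p q u v 0 ->
    exists d, 0 < d /\ forall x y h, 0 < h < d -> nested x0 y0 p q x y h ->
      x <= u <= x + h * p -> y <= v <= y + h * q -> m x y h <= eta * h ^ 2) :
  m x0 y0 1 <= 0.
Proof.
set (inside := nested x0 y0 p q) in *.
apply Rnot_lt_le; intros Hc; set (c := m x0 y0 1) in *.
set (good := fun (s : R * R) h => 0 < h /\ inside (fst s) (snd s) h /\ c * h ^ 2 <= m (fst s) (snd s) h).
assert (step : forall s h, exists s', good s h -> good s' (h / 2) /\
   fst s <= fst s' <= fst s + h / 2 * p /\ snd s <= snd s' <= snd s + h / 2 * q).
{ intros [x y] h.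
  destruct (classic (good (x, y) h)) as [[Hh [Hi Hm]] | N]; [| exists (x, y); tauto].
  simpl in Hi, Hm.
  assert (Hs := subadd x y h Hh Hi).
  destruct Hi as [I1 [I2 [I3 I4]]].
  assert (0 < h * p) by nra; assert (0 < h * q) by nra.
  (* Otherwise the four quarters would add up to less than [c h ^ 2]. *)
  assert (E : exists x' y', (x' = x \/ x' = x + h / 2 * p) /\ (y' = y \/ y' = y + h / 2 * q) /\
     c * (h / 2) ^ 2 <= m x' y' (h / 2)).
  { apply NNPP; intros N.
    assert (A : forall x' y', (x' = x \/ x' = x + h / 2 * p) -> (y' = y \/ y' = y + h / 2 * q) ->
      m x' y' (h / 2) < c * (h / 2) ^ 2).
    { intros x' y' h1 h2; apply Rnot_le_lt; intros L; apply N; eauto. }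
    assert (A1 := A x y); assert (A2 := A (x + h / 2 * p) y).
    assert (A3 := A x (y + h / 2 * q)); assert (A4 := A (x + h / 2 * p) (y + h / 2 * q)).
    assert (c * h ^ 2 = 4 * (c * (h / 2) ^ 2)) by field.
    specialize (A1 (or_introl eq_refl) (or_introl eq_refl)).
    specialize (A2 (or_intror eq_refl) (or_introl eq_refl)).
    specialize (A3 (or_introl eq_refl) (or_intror eq_refl)).
    specialize (A4 (or_intror eq_refl) (or_intror eq_refl)). lra. }
  destruct E as [x' [y' [Hx [Hy Hm']]]].
  exists (x', y'); intros _; simpl.
  assert (h * p = h / 2 * p + h / 2 * p) by field; assert (h * q = h / 2 * q + h / 2 * q) by field.
  repeat split; simpl; auto; try lra; destruct Hx, Hy; subst; lra. }
set (next := fun s h => epsilon (inhabits s) (fun s' => good s h -> good s' (h / 2) /\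
   fst s <= fst s' <= fst s + h / 2 * p /\ snd s <= snd s' <= snd s + h / 2 * q)).
assert (Hnext := fun s h => epsilon_spec (inhabits s) _ (step s h)); fold (next) in Hnext.
set (sq := fix sq n := match n with O => (x0, y0) | S n => next (sq n) ((/ 2) ^ n) end).
assert (Hg : forall n, good (sq n) ((/ 2) ^ n)).
{ induction n; simpl.
  - repeat split; simpl; lra || (unfold c; lra).
  - replace (/ 2 * (/ 2) ^ n) with ((/ 2) ^ n / 2) by field. now apply Hnext. }
assert (Hs : forall n, fst (sq n) <= fst (sq (S n)) /\ fst (sq (S n)) + (/2) ^ S n * p <= fst (sq n) + (/2) ^ n * p
  /\ snd (sq n) <= snd (sq (S n)) /\ snd (sq (S n)) + (/2) ^ S n * q <= snd (sq n) + (/2) ^ n * q).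
{ intros n; destruct (Hnext (sq n) _ (Hg n)) as [_ [H1 H2]].
  change (sq (S n)) with (next (sq n) ((/2)^n)).
  unfold next.
  simpl pow; replace (/ 2 * (/ 2) ^ n) with ((/ 2) ^ n / 2) by field.
  assert ((/2)^n*p = (/2)^n / 2 * p + (/2)^n / 2 * p) by field.
  assert ((/2)^n*q = (/2)^n / 2 * q + (/2)^n / 2 * q) by field. lra. }
assert (L : forall n k, fst (sq n) <= fst (sq (n + k)%nat) /\ fst (sq (n + k)%nat) + (/2)^(n+k) * p <= fst (sq n) + (/2)^n * p
  /\ snd (sq n) <= snd (sq (n + k)%nat) /\ snd (sq (n + k)%nat) + (/2)^(n+k) * q <= snd (sq n) + (/2)^n * q).
{ intros n; induction k; [rewrite Nat.add_0_r; lra |].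
  rewrite Nat.add_succ_r; generalize (Hs (n + k)%nat); lra. }
assert (P2 : forall n, 0 < (/2)^n) by (intros; apply pow_lt; lra).
assert (M : forall n k, fst (sq k) <= fst (sq n) + (/2)^n * p /\ snd (sq k) <= snd (sq n) + (/2)^n * q).
{ intros n k; assert (Pp := Rmult_lt_0_compat _ _ (P2 k) hp); assert (Pq := Rmult_lt_0_compat _ _ (P2 k) hq).
  assert (Pp' := Rmult_lt_0_compat _ _ (P2 n) hp); assert (Pq' := Rmult_lt_0_compat _ _ (P2 n) hq).
  destruct (Nat.le_ge_cases n k) as [H | H].
  - generalize (L n (k - n)%nat); replace (n + (k - n))%nat with k by lia; lra.
  - generalize (L k (n - k)%nat); replace (k + (n - k))%nat with n by lia; lra. }
destruct (completeness (fun r => exists n, r = fst (sq n))) as [u [Hu1 Hu2]].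
{ exists (fst (sq O) + (/2)^0 * p); intros r [n ->]; apply M. }
{ exists (fst (sq O)), O; auto. }
destruct (completeness (fun r => exists n, r = snd (sq n))) as [v [Hv1 Hv2]].
{ exists (snd (sq O) + (/2)^0 * q); intros r [n ->]; apply M. }
{ exists (snd (sq O)), O; auto. }
assert (Hu : forall n, fst (sq n) <= u <= fst (sq n) + (/2)^n * p).
{ intros n; split; [apply Hu1; eauto | apply Hu2; intros r [k ->]; apply M]. }
assert (Hv : forall n, snd (sq n) <= v <= snd (sq n) + (/2)^n * q).
{ intros n; split; [apply Hv1; eauto | apply Hv2; intros r [k ->]; apply M]. }
destruct (small u v (c / 2)) as [d [Hd Hsm]]; [lra | |].
{ generalize (Hu O) (Hv O); unfold inside, nested; simpl; lra. }
destruct (pow_lt_1_zero (/ 2)) with (y := d) as [N HN]; auto.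
{ rewrite Rabs_pos_eq; lra. }
specialize (HN N (Nat.le_refl N)); rewrite Rabs_pos_eq in HN by (apply Rlt_le, P2).
destruct (Hg N) as [_ [Hi Hm]].
specialize (Hsm _ _ _ (conj (P2 N) HN) Hi (Hu N) (Hv N)).
assert (0 < c * ((/2)^N)^2) by (apply Rmult_lt_0_compat; [lra | apply pow_lt, P2]). lra.
Qed.

(** * The theorem of Goursat on a cone over a circle *)

Definition cis (t : R) : C := (cos t, sin t).

Lemma Cmod_cis t : Cmod (cis t) = 1.
Proof.
unfold Cmod, cis; simpl; transitivity (sqrt 1); [f_equal | apply sqrt_1].
transitivity (Rsqr (sin t) + Rsqr (cos t)); [unfold Rsqr; ring | apply sin2_cos2].
Qed.

Lemma cis_neq_0 t : cis t <> 0%C.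
Proof. apply Cmod_gt_0; rewrite Cmod_cis; lra. Qed.

Lemma Cderiv_cis t : Cderiv cis t (Ci * cis t)%C.
Proof. split; unfold cis; simpl; auto_derive; auto; ring. Qed.

Lemma Ccts_cis t : Ccts cis t.
Proof. exact (Cderiv_cts _ _ _ (Cderiv_cis t)). Qed.

(** The chord is the integral of the derivative [i cis], which has modulus
    [1]. *)
Lemma cis_lipschitz a b : Cmod (cis b - cis a) <= Rabs (b - a).
Proof.
assert (A : forall a b, a <= b -> Cmod (cis b - cis a) <= b - a).
{ clear; intros a b ab.
  assert (K : Ccts_on (fun t => Ci * cis t)%C a b).
  { intros x _; apply Ccts_mult; [apply Ccts_const | apply Ccts_cis]. }
  rewrite <- (Cint_FTC cis (fun t => Ci * cis t)%C a b ab K) by (intros; apply Cderiv_cis).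
  rewrite <- (Rmult_1_l (b - a)); apply Cint_bound; auto.
  intros x _; rewrite Cmod_mult, Cmod_Ci, Cmod_cis; lra. }
destruct (Rle_dec a b).
- rewrite Rabs_pos_eq by lra; auto.
- replace (cis b - cis a)%C with (- (cis a - cis b))%C by ring.
  rewrite Cmod_opp, Rabs_left by lra. replace (- (b - a)) with (a - b) by ring; apply A; lra.
Qed.

Lemma cis_2PI : cis (2 * PI) = cis 0.
Proof. unfold cis; now rewrite cos_2PI, sin_2PI, cos_0, sin_0. Qed.

(** An affine function has a quadratic primitive, so its path integral only
    sees the endpoints; [g] then contributes no more than its distance to the
    affine function, times the length of the path. *)
Lemma path_affine (g : C -> C) (c c' : R -> C) a b (l0 l : C) M1 M2 :
  a <= b -> 0 <= M1 -> Ccts_on (fun s => g (c s)) a b ->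
  (forall s, a <= s <= b -> Cderiv c s (c' s)) -> Ccts_on c' a b ->
  (forall s, a <= s <= b -> Cmod (g (c s) - (l0 + l * c s)) <= M1) ->
  (forall s, a <= s <= b -> Cmod (c' s) <= M2) ->
  Cmod (Cint (fun s => g (c s) * c' s)%C a b
        - ((l0 * c b + l / 2 * (c b * c b)) - (l0 * c a + l / 2 * (c a * c a)))) <= M1 * M2 * (b - a).
Proof.
intros ab HM Hg Hc Hc' H1 H2.
assert (Cc : Ccts_on c a b) by (intros x Hx; exact (Cderiv_cts _ _ _ (Hc x Hx))).
assert (K1 : Ccts_on (fun s => (l0 + l * c s) * c' s)%C a b).
{ intros x Hx; apply Ccts_mult; auto; apply Ccts_plus; [apply Ccts_const |].
  apply Ccts_mult; auto; apply Ccts_const. }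
assert (K2 : Ccts_on (fun s => (g (c s) + (-1) * (l0 + l * c s)) * c' s)%C a b).
{ intros x Hx; apply Ccts_mult; auto; apply Ccts_plus; auto.
  apply Ccts_mult; [apply Ccts_const |]; apply Ccts_plus; [apply Ccts_const |].
  apply Ccts_mult; auto; apply Ccts_const. }
rewrite (Cint_ext _ (fun s => (g (c s) + (-1) * (l0 + l * c s)) * c' s + (l0 + l * c s) * c' s)%C)
  by (auto; intros; ring).
rewrite Cint_plus by auto.
rewrite (Cint_FTC (fun s => l0 * c s + l / 2 * (c s * c s))%C (fun s => (l0 + l * c s) * c' s)%C a b); auto.
- match goal with |- Cmod ?e <= _ =>
    replace e with (Cint (fun s => (g (c s) + (-1) * (l0 + l * c s)) * c' s)%C a b) by ring end.
  apply Cint_bound; auto.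
  intros x Hx; rewrite Cmod_mult; apply Rmult_le_compat; auto using Cmod_ge_0.
  replace (g (c x) + -1 * (l0 + l * c x))%C with (g (c x) - (l0 + l * c x))%C by ring; auto.
- intros x Hx.
  replace ((l0 + l * c x) * c' x)%C with
   ((0 * c x + l0 * c' x) + (0 * (c x * c x) + l / 2 * (c' x * c x + c x * c' x)))%C by field.
  apply Cderiv_plus; apply Cderiv_mult; auto using Cderiv_const, Cderiv_mult.
Qed.

(** The disk seen as a cone with apex [z] over the circle of radius [r].  The
    apex is reached only at [t = 0], so a singularity at [z] stays outside
    every rectangle with [t > 0], and [t = 1] is the circle itself. *)
Definition cone (z : C) (r t a : R) : C := (z + t * (r * cis a - z))%C.
(** Integrals of [g dw] along the images of the two kinds of edges of a
    parameter rectangle. *)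
Definition radial (g : C -> C) z r a t1 t2 : C :=
  Cint (fun t => g (cone z r t a) * (r * cis a - z))%C t1 t2.
Definition angular (g : C -> C) z r t a1 a2 : C :=
  Cint (fun a => g (cone z r t a) * (t * (r * (Ci * cis a))))%C a1 a2.
Definition boundary_integral g z r t1 t2 a1 a2 : C :=
  (radial g z r a1 t1 t2 + angular g z r t2 a1 a2
   - radial g z r a2 t1 t2 - angular g z r t1 a1 a2)%C.

Lemma cone_deriv_t z r a t : Cderiv (fun t => cone z r t a) t (r * cis a - z)%C.
Proof. split; unfold cone; simpl; auto_derive; auto; ring. Qed.

Lemma cone_deriv_a z r a t : Cderiv (cone z r t) a (t * (r * (Ci * cis a)))%C.
Proof. split; unfold cone; simpl; auto_derive; auto; ring. Qed.

(** The lower bound keeps the cone away from its apex. *)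
Lemma spoke_bounds z r a : Cmod z < r -> 0 < Cmod (r * cis a - z) <= 2 * r.
Proof.
intros H; assert (P := Cmod_ge_0 z).
assert (E : Cmod (r * cis a) = r) by (rewrite Cmod_mult, Cmod_cis, Cmod_R, Rabs_pos_eq; lra).
split.
- assert (T := Cmod_triangle (r * cis a - z) z).
  replace (r * cis a - z + z)%C with (r * cis a)%C in T by ring; lra.
- assert (T := Cmod_triangle (r * cis a) (- z)); rewrite Cmod_opp in T; unfold Cminus; lra.
Qed.

Lemma cone_neq z r t a : Cmod z < r -> 0 < t -> cone z r t a <> z.
Proof.
intros H Ht E; assert (B := spoke_bounds z r a H).
assert (Z : (t * (r * cis a - z))%C = 0%C).
{ replace (t * (r * cis a - z))%C with (cone z r t a - z)%C by (unfold cone; ring). rewrite E; ring. }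
assert (K : Cmod (t * (r * cis a - z)) = 0) by (rewrite Z; apply Cmod_0).
rewrite Cmod_mult, Cmod_R, Rabs_pos_eq in K by lra; nra.
Qed.

Definition holomorphic_off (z : C) (g : C -> C) : Prop :=
  forall w, w <> z -> exists l, Cdiff g w l.

Lemma radial_cts g z r a t : Cmod z < r -> holomorphic_off z g -> 0 < t ->
  Ccts (fun t => g (cone z r t a) * (r * cis a - z))%C t.
Proof.
intros hz hg Ht; apply Ccts_mult; [| apply Ccts_const].
destruct (hg (cone z r t a)) as [l Hl]; [now apply cone_neq |].
apply Ccts_comp_diff with l; auto. exact (Cderiv_cts _ _ _ (cone_deriv_t z r a t)).
Qed.

Lemma angular_cts g z r a t : Cmod z < r -> holomorphic_off z g -> 0 < t ->
  Ccts (fun a => g (cone z r t a) * (t * (r * (Ci * cis a))))%C a.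
Proof.
intros hz hg Ht; apply Ccts_mult.
- destruct (hg (cone z r t a)) as [l Hl]; [now apply cone_neq |].
  apply (Ccts_comp_diff g l (cone z r t)); auto. exact (Cderiv_cts _ _ _ (cone_deriv_a z r a t)).
- do 3 (apply Ccts_mult; [apply Ccts_const |]); apply Ccts_cis.
Qed.

Lemma boundary_integral_split g z r t1 t2 t3 a1 a2 a3 :
  Cmod z < r -> holomorphic_off z g -> 0 < t1 -> t1 <= t2 <= t3 -> a1 <= a2 <= a3 ->
  boundary_integral g z r t1 t3 a1 a3 =
  (boundary_integral g z r t1 t2 a1 a2 + boundary_integral g z r t2 t3 a1 a2
   + boundary_integral g z r t1 t2 a2 a3 + boundary_integral g z r t2 t3 a2 a3)%C.
Proof.
intros hz hg Ht1 Ht Ha; unfold boundary_integral.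
assert (A : forall a, radial g z r a t1 t3 = (radial g z r a t1 t2 + radial g z r a t2 t3)%C).
{ intros a; apply Cint_Chasles; auto; intros x Hx; apply radial_cts; auto; lra. }
assert (B : forall t, 0 < t -> angular g z r t a1 a3 = (angular g z r t a1 a2 + angular g z r t a2 a3)%C).
{ intros t Ht'; apply Cint_Chasles; auto; intros x Hx; apply angular_cts; auto. }
rewrite !A, !B by lra; ring.
Qed.

Lemma cone_lipschitz z r t a u v : Cmod z < r -> 0 <= t <= 1 -> 0 <= u <= 1 ->
  Cmod (cone z r t a - cone z r u v) <= 2 * r * (Rabs (t - u) + Rabs (a - v)).
Proof.
intros hz Ht Hu; assert (Pz := Cmod_ge_0 z).
replace (cone z r t a - cone z r u v)%C with
  ((t - u)%R * (r * cis a - z) + u * (r * (cis a - cis v)))%C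
  by (unfold cone; rewrite RtoC_minus; ring).
eapply Rle_trans; [apply Cmod_triangle |].
rewrite !Cmod_mult, !Cmod_R, (Rabs_pos_eq u), (Rabs_pos_eq r) by lra.
assert (B := spoke_bounds z r a hz); assert (L := cis_lipschitz v a).
assert (P1 := Rabs_pos (t - u)); assert (P2 := Cmod_ge_0 (cis a - cis v)).
assert (u * (r * Cmod (cis a - cis v)) <= 1 * (r * Rabs (a - v))).
{ apply Rmult_le_compat; try lra; [apply Rmult_le_pos; lra |].
  apply Rmult_le_compat_l; lra. }
assert (Rabs (t - u) * Cmod (r * cis a - z) <= Rabs (t - u) * (2 * r)) by (apply Rmult_le_compat_l; lra).
assert (0 <= r * Rabs (a - v)) by (apply Rmult_le_pos; [lra | apply Rabs_pos]).
nra.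
Qed.

(** The four endpoint terms given by [path_affine] cancel around the
    boundary, and the error is a sup norm times a perimeter.  When [M] is the
    error of a derivative it is of the order of the diameter, which makes the
    whole bound quadratic in the size of the rectangle. *)
Lemma boundary_integral_affine g z r t1 t2 a1 a2 (l0 l : C) M :
  Cmod z < r -> holomorphic_off z g -> 0 < t1 -> t1 <= t2 <= 1 -> a1 <= a2 -> 0 <= M ->
  (forall t a, t1 <= t <= t2 -> a1 <= a <= a2 ->
    Cmod (g (cone z r t a) - (l0 + l * cone z r t a)) <= M) ->
  Cmod (boundary_integral g z r t1 t2 a1 a2) <= 4 * r * M * ((t2 - t1) + (a2 - a1)).
Proof.
intros hz hg Ht1 Ht Ha HM H.
assert (hr : 0 < r) by (generalize (Cmod_ge_0 z); lra).
assert (R : forall a, a1 <= a <= a2 -> Cmod (radial g z r a t1 t2 - 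
   ((l0 * cone z r t2 a + l / 2 * (cone z r t2 a * cone z r t2 a)) -
    (l0 * cone z r t1 a + l / 2 * (cone z r t1 a * cone z r t1 a)))) <= M * (2 * r) * (t2 - t1)).
{ intros a Ha'.
  apply (path_affine g (fun t => cone z r t a) (fun _ => r * cis a - z)%C); auto; try lra.
  - intros t Ht'. destruct (hg (cone z r t a)) as [m Hm]; [apply cone_neq; auto; lra |].
    apply Ccts_comp_diff with m; auto. exact (Cderiv_cts _ _ _ (cone_deriv_t z r a t)).
  - intros; apply cone_deriv_t.
  - intros t _; apply Ccts_const.
  - intros s _; now apply spoke_bounds. }
assert (A : forall t, t1 <= t <= t2 -> Cmod (angular g z r t a1 a2 - 
   ((l0 * cone z r t a2 + l / 2 * (cone z r t a2 * cone z r t a2)) -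
    (l0 * cone z r t a1 + l / 2 * (cone z r t a1 * cone z r t a1)))) <= M * (2 * r) * (a2 - a1)).
{ intros t Ht'.
  apply (path_affine g (cone z r t) (fun a => t * (r * (Ci * cis a)))%C); auto; try lra.
  - intros a Ha'. destruct (hg (cone z r t a)) as [m Hm]; [apply cone_neq; auto; lra |].
    apply (Ccts_comp_diff g m (cone z r t)); auto. exact (Cderiv_cts _ _ _ (cone_deriv_a z r a t)).
  - intros; apply cone_deriv_a.
  - intros a _; do 3 (apply Ccts_mult; [apply Ccts_const |]); apply Ccts_cis.
  - intros a _; rewrite !Cmod_mult, !Cmod_R, Cmod_Ci, Cmod_cis, !Rabs_pos_eq by lra; nra. }
assert (R1 := R a1 ltac:(lra)); assert (R2 := R a2 ltac:(lra)).
assert (A1 := A t1 ltac:(lra)); assert (A2 := A t2 ltac:(lra)); clear R A.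
unfold boundary_integral.
match type of R1 with Cmod ?e <= _ => set (e1 := e) in * end.
match type of R2 with Cmod ?e <= _ => set (e2 := e) in * end.
match type of A1 with Cmod ?e <= _ => set (e3 := e) in * end.
match type of A2 with Cmod ?e <= _ => set (e4 := e) in * end.
replace (radial g z r a1 t1 t2 + angular g z r t2 a1 a2 - radial g z r a2 t1 t2 - angular g z r t1 a1 a2)%C
  with (e1 + e4 + - e2 + - e3)%C by (unfold e1, e2, e3, e4; ring).
eapply Rle_trans; [apply Cmod_triangle |]; eapply Rle_trans; [apply Rplus_le_compat_r, Cmod_triangle |].
eapply Rle_trans; [apply Rplus_le_compat_r, Rplus_le_compat_r, Cmod_triangle |].
rewrite !Cmod_opp; lra.
Qed.

(** At a point where [g] is differentiable, [boundary_integral_affine] with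
    the tangent affine function gives [o (h ^ 2)], which is what [bisection]
    asks for. *)
Lemma goursat g z r t0 : Cmod z < r -> holomorphic_off z g -> 0 < t0 < 1 ->
  boundary_integral g z r t0 1 0 (2 * PI) = 0%C.
Proof.
intros hz hg Ht0; assert (hr : 0 < r) by (generalize (Cmod_ge_0 z); lra).
assert (Ppi := PI_RGT_0).
assert (B := bisection (fun t a h => Cmod (boundary_integral g z r t (t + h * (1 - t0)) a (a + h * (2 * PI))))
  t0 0 (1 - t0) (2 * PI)).
assert (E : Cmod (boundary_integral g z r t0 1 0 (2 * PI)) <= 0).
{ replace 1 with (t0 + 1 * (1 - t0)) at 1 by ring.
  replace (2 * PI) with (0 + 1 * (2 * PI)) at 1 by ring.
  apply B; clear B; [lra | lra | |].
  - intros t a h Hh [I1 [I2 [I3 I4]]].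
    rewrite (boundary_integral_split g z r t (t + h / 2 * (1 - t0)) _ a (a + h / 2 * (2 * PI))) by (auto; nra).
    replace (t + h / 2 * (1 - t0) + h / 2 * (1 - t0)) with (t + h * (1 - t0)) by field.
    replace (a + h / 2 * (2 * PI) + h / 2 * (2 * PI)) with (a + h * (2 * PI)) by field.
    eapply Rle_trans; [apply Cmod_triangle |]; apply Rplus_le_compat_r.
    eapply Rle_trans; [apply Cmod_triangle |]; apply Rplus_le_compat_r.
    apply Cmod_triangle.
  - intros u v eta Heta [I1 [I2 [I3 I4]]].
    destruct (hg (cone z r u v)) as [l Hl]; [apply cone_neq; auto; lra |].
    set (p := 1 - t0) in *; set (q := 2 * PI) in *.
    set (S := p + q); assert (HS : 0 < S) by (unfold S, p, q; lra).
    (* The derivative error [e] solves [4 r (e 2 r S h) (S h) = eta h ^ 2]. *)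
    assert (He : 0 < eta / (8 * r * r * S * S)).
    { apply Rdiv_lt_0_compat; auto; repeat apply Rmult_lt_0_compat; lra. }
    destruct (Hl _ He) as [d [Hd Hw]]; clear Hl.
    set (e := eta / (8 * r * r * S * S)) in *.
    assert (HrS : 0 < 2 * r * S) by (repeat apply Rmult_lt_0_compat; lra).
    exists (d / (2 * r * S)); split; [now apply Rdiv_lt_0_compat |].
    intros t a h [Hh1 Hh2] [J1 [J2 [J3 J4]]] Hu Hv.
    apply (Rmult_lt_compat_l _ _ _ HrS) in Hh2.
    replace (2 * r * S * (d / (2 * r * S))) with d in Hh2 by (field; lra).
    assert (hp : 0 < h * p) by (apply Rmult_lt_0_compat; unfold p; lra).
    assert (hq : 0 < h * q) by (apply Rmult_lt_0_compat; unfold q; lra).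
    assert (K := boundary_integral_affine g z r t (t + h * p) a (a + h * q)
      (g (cone z r u v) - l * cone z r u v)%C l (e * (2 * r * S * h))).
    eapply Rle_trans; [apply K; clear K; auto; try lra |].
    + unfold p in *; lra.
    + apply Rmult_le_pos; [lra | apply Rmult_le_pos; lra].
    + intros t' a' Ht' Ha'.
      assert (D : Cmod (cone z r t' a' - cone z r u v) <= 2 * r * S * h).
      { eapply Rle_trans; [apply cone_lipschitz; auto; unfold p in *; lra |].
        rewrite (Rmult_assoc (2 * r)); apply Rmult_le_compat_l; [lra |].
        unfold S; assert (Rabs (t' - u) <= h * p) by (apply Rabs_le; lra).
        assert (Rabs (a' - v) <= h * q) by (apply Rabs_le; lra). lra. }
      specialize (Hw (cone z r t' a') ltac:(lra)).
      replace (g (cone z r t' a') - (g (cone z r u v) - l * cone z r u v + l * cone z r t' a'))%C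
        with (g (cone z r t' a') - g (cone z r u v) - l * (cone z r t' a' - cone z r u v))%C by ring.
      eapply Rle_trans; [exact Hw |]; apply Rmult_le_compat_l; lra.
    + apply Req_le; unfold e, S in *; field; lra. }
apply Cmod_eq_0; apply Rle_antisym; auto using Cmod_ge_0.
Qed.

(** By [goursat] the boundary integral over [[t, 1] * [0, 2 PI]] is zero; its
    two radial edges coincide, so the integral over the circle equals the one
    over the small loop at height [t], which is [O (t)] because [g] is bounded
    near the apex. *)
Lemma circle_integral_vanishes g z r : Cmod z < r -> holomorphic_off z g ->
  (exists d M, 0 < d /\ forall w, 0 < Cmod (w - z) < d -> Cmod (g w) <= M) ->
  Cint (fun a => g (r * cis a) * (r * cis a))%C 0 (2 * PI) = 0%C.
Proof.
intros hz hg [d [M [Hd HM]]]; assert (hr : 0 < r) by (generalize (Cmod_ge_0 z); lra).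
assert (Ppi := PI_RGT_0).
assert (A : forall t, 0 < t < 1 -> angular g z r 1 0 (2 * PI) = angular g z r t 0 (2 * PI)).
{ intros t Ht; assert (G := goursat g z r t hz hg Ht); unfold boundary_integral in G.
  assert (E : radial g z r (2 * PI) t 1 = radial g z r 0 t 1) by (unfold radial, cone; now rewrite cis_2PI).
  rewrite E in G.
  replace (angular g z r t 0 (2 * PI)) with (angular g z r t 0 (2 * PI) + 0)%C by ring.
  rewrite <- G; ring. }
assert (HM0 : 0 <= M).
{ eapply Rle_trans; [| apply (HM (z + d / 2)%C)]; [apply Cmod_ge_0 |].
  replace (z + d / 2 - z)%C with (RtoC (d / 2)) by (rewrite RtoC_div; [ring | lra]).
  rewrite Cmod_R, Rabs_pos_eq; lra. }
assert (Z : Cmod (angular g z r 1 0 (2 * PI)) <= 0).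
{ apply le_epsilon; intros e He.
  set (t := Rmin (1 / 2) (Rmin (d / (4 * r)) (e / (2 * PI * r * (M + 1))))).
  assert (K : 0 < 2 * PI * r * (M + 1)) by (apply Rmult_lt_0_compat; [apply Rmult_lt_0_compat |]; lra).
  assert (Ht : 0 < t) by (unfold t; repeat apply Rmin_pos; try lra; apply Rdiv_lt_0_compat; lra).
  assert (T1 : t <= 1 / 2) by apply Rmin_l.
  assert (T2 : t <= d / (4 * r)) by (eapply Rle_trans; [apply Rmin_r | apply Rmin_l]).
  assert (T3 : t <= e / (2 * PI * r * (M + 1))) by (eapply Rle_trans; [apply Rmin_r | apply Rmin_r]).
  apply Rle_div_r in T2; [| lra]; apply Rle_div_r in T3; auto.
  rewrite (A t) by lra.
  eapply Rle_trans; [apply (Cint_bound _ _ _ (M * (t * r))); [lra | |] |].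
  - intros a _; now apply angular_cts.
  - intros a _; rewrite !Cmod_mult, Cmod_Ci, Cmod_cis, !Cmod_R, !Rabs_pos_eq by lra.
    rewrite !Rmult_1_l, Rmult_1_r; apply Rmult_le_compat_r; [apply Rmult_le_pos; lra |]; apply HM.
    replace (cone z r t a - z)%C with (t * (r * cis a - z))%C by (unfold cone; ring).
    rewrite Cmod_mult, Cmod_R, Rabs_pos_eq by lra.
    assert (S := spoke_bounds z r a hz); split; [apply Rmult_lt_0_compat; lra | nra].
  - assert (0 <= t * r * PI) by (apply Rmult_le_pos; [apply Rmult_le_pos |]; lra). nra. }
assert (E : angular g z r 1 0 (2 * PI) = (Ci * Cint (fun a => g (r * cis a) * (r * cis a)) 0 (2 * PI))%C).
{ unfold angular.
  rewrite <- Cint_scal; [| lra |].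
  - apply Cint_ext; [lra |]; intros a _.
    replace (cone z r 1 a) with (r * cis a)%C by (unfold cone; ring). ring.
  - intros a _; apply (continuous_ext (fun a => - Ci * (g (cone z r 1 a) * (1 * (r * (Ci * cis a)))))%C).
    + intros b; match goal with |- ?x = ?y => change (@eq C x y) end.
      replace (cone z r 1 b) with (r * cis b)%C by (unfold cone; ring).
      replace (- Ci * (g (r * cis b) * (1 * (r * (Ci * cis b)))))%C with
        (- (Ci * Ci) * (g (r * cis b) * (r * cis b)))%C by ring.
      replace (- (Ci * Ci))%C with (RtoC 1) by (apply C_eq; simpl; ring). ring.
    + apply Ccts_mult; [apply Ccts_const | apply angular_cts; auto; lra]. }
rewrite E, Cmod_mult, Cmod_Ci, Rmult_1_l in Z.
apply Cmod_eq_0, Rle_antisym; auto using Cmod_ge_0.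
Qed.

(** * Orthogonality of powers on a circle *)

Lemma RtoC_neq (x : R) : x <> 0 -> RtoC x <> 0%C.
Proof. intros H E; apply H; exact (RtoC_inj _ _ E). Qed.

Definition holomorphic (f : C -> C) : Prop := forall z, exists l, Cdiff f z l.

Fixpoint psum (a : nat -> C) (N : nat) (z : C) : C :=
  match N with O => 0%C | S n => (psum a n z + a n * z ^ n)%C end.

Lemma Ccts_on_circle f r a : holomorphic f -> Ccts (fun a => f (r * cis a)%C) a.
Proof.
intros hf; destruct (hf (r * cis a)%C) as [l Hl].
apply (Ccts_comp_diff f l (fun a => r * cis a)%C); auto.
apply Ccts_mult; [apply Ccts_const | apply Ccts_cis].
Qed.

Lemma holomorphic_psum a N : holomorphic (psum a N).
Proof.
induction N; intros z; simpl.
- eexists; apply Cdiff_const.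
- destruct (IHN z) as [l Hl].
  assert (P : forall n, exists m, Cdiff (fun z => (z ^ n)%C) z m).
  { induction n as [| n [m Hm]]; [exists (RtoC 0); exact (Cdiff_const _ z) |].
    eexists; exact (Cdiff_mult (fun z => z) (fun z => (z ^ n)%C) z _ _ (Cdiff_id z) Hm). }
  destruct (P N) as [m Hm].
  eexists; apply Cdiff_plus; [exact Hl |].
  exact (Cdiff_mult (fun _ => a N) (fun z => (z ^ N)%C) z _ _ (Cdiff_const _ z) Hm).
Qed.

Lemma Ccts_pow (c : R -> C) k t : Ccts c t -> Ccts (fun s => (c s ^ k)%C) t.
Proof.
intros H; induction k; simpl; [apply Ccts_const | exact (Ccts_mult _ _ _ H IHk)].
Qed.

Lemma Cderiv_exponential_pow (c : R -> C) (kappa : C) k t :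
  Cderiv c t (kappa * c t)%C -> Cderiv (fun s => (c s ^ k)%C) t (INR k * kappa * c t ^ k)%C.
Proof.
intros H; induction k.
- simpl; replace (0 * kappa * 1)%C with (RtoC 0) by ring; apply Cderiv_const.
- rewrite S_INR, RtoC_plus, Cpow_S.
  replace ((INR k + 1) * kappa * (c t * c t ^ k))%C with
    ((kappa * c t) * c t ^ k + c t * (INR k * kappa * c t ^ k))%C by ring.
  exact (Cderiv_mult _ _ _ _ _ H IHk).
Qed.

(** If [c' = kappa c], then [c ^ k / (k kappa)] is a primitive of [c ^ k], and
    it takes the same value at both ends.  It serves both for [w] and for
    [1 / w] on a circle. *)
Lemma Cint_exponential_pow (c : R -> C) (kappa : C) k : kappa <> 0%C ->
  (forall t, Cderiv c t (kappa * c t)%C) -> c 0 = c (2 * PI) -> (0 < k)%nat ->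
  Cint (fun t => c t ^ k)%C 0 (2 * PI) = 0%C.
Proof.
intros Hk Hc Hp K; assert (Ppi := PI_RGT_0).
assert (Ik : RtoC (INR k) <> 0%C).
{ apply RtoC_neq; apply not_0_INR; lia. }
assert (Cc : forall t, Ccts (fun s => (c s ^ k)%C) t).
{ intros t; apply Ccts_pow; exact (Cderiv_cts _ _ _ (Hc t)). }
assert (E : (INR k * kappa * Cint (fun t => c t ^ k)%C 0 (2 * PI))%C = 0%C).
{ rewrite <- Cint_scal by (try lra; intros x _; apply Cc).
  rewrite (Cint_FTC (fun s => (c s ^ k)%C)).
  - rewrite Hp; ring.
  - lra.
  - intros x _; apply Ccts_mult; [apply Ccts_const | apply Cc].
  - intros x _; now apply Cderiv_exponential_pow. }
destruct (Ceq_dec (Cint (fun t => c t ^ k)%C 0 (2 * PI)) 0) as [H | H]; auto.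
exfalso; revert E; now repeat apply Cmult_neq_0.
Qed.

Lemma Cint_const (c : C) a b : a <= b -> Cint (fun _ => c) a b = (c * (b - a)%R)%C.
Proof.
intros ab. rewrite (Cint_FTC (fun t => c * t)%C); auto.
- rewrite RtoC_minus; ring.
- intros x _; apply Ccts_const.
- intros x _; split; simpl; auto_derive; auto; unfold Re, Im; ring.
Qed.

Lemma circle_neq_0 r a : 0 < r -> (r * cis a)%C <> 0%C.
Proof. intros H; apply Cmult_neq_0; [apply RtoC_neq; lra | apply cis_neq_0]. Qed.

Lemma Cmod_circle r a : 0 < r -> Cmod (r * cis a) = r.
Proof. intros H; rewrite Cmod_mult, Cmod_cis, Cmod_R, Rabs_pos_eq; lra. Qed.

Lemma Ccts_circle r a : Ccts (fun a => r * cis a)%C a.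
Proof. apply Ccts_mult; [apply Ccts_const | apply Ccts_cis]. Qed.

(** On the circle, inversion is conjugation up to scale, which gives the
    derivative without a chain rule. *)
Lemma Cderiv_inv_cis r t : 0 < r -> Cderiv (fun a => / (r * cis a))%C t (- Ci * / (r * cis t))%C.
Proof.
intros Hr.
assert (E : forall a, (/ (r * cis a))%C = ((/ r)%R * cis (- a))%C).
{ intros a; rewrite RtoC_inv by lra.
  assert (H : (cis a * cis (- a))%C = 1%C).
  { apply C_eq; unfold cis; simpl; rewrite cos_neg, sin_neg.
    - generalize (sin2_cos2 a); unfold Rsqr; lra.
    - ring. }
  assert (Hr' : RtoC r <> 0%C) by (apply RtoC_neq; lra).
  replace (cis (- a))%C with (/ cis a)%C; [field; auto using cis_neq_0 |].
  replace (cis (- a)) with (/ cis a * (cis a * cis (- a)))%C by (field; apply cis_neq_0).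
  rewrite H; field; apply cis_neq_0. }
rewrite E; split.
- apply (is_derive_ext (fun a => Re ((/ r)%R * cis (- a))%C)); [intros; now rewrite E |].
  unfold cis; simpl; auto_derive; auto; ring.
- apply (is_derive_ext (fun a => Im ((/ r)%R * cis (- a))%C)); [intros; now rewrite E |].
  unfold cis; simpl; auto_derive; auto; ring.
Qed.

Lemma Ccts_inv_pow r n t : 0 < r -> Ccts (fun a => / (r * cis a) ^ n)%C t.
Proof.
intros Hr. apply (continuous_ext (fun a => ((/ (r * cis a)) ^ n)%C)).
- intros a; apply Cpow_inv, circle_neq_0; auto.
- apply Ccts_pow; exact (Cderiv_cts _ _ _ (Cderiv_inv_cis r t Hr)).
Qed.

(** Syntax-directed proof of continuity in the angle; it never unfolds the
    complex operations, which would make unification explode. *)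
Ltac ccts := repeat match goal with
  | |- Ccts_on _ _ _ => intros ? _
  | |- continuous (fun _ => ?c) _ => apply Ccts_const
  | |- continuous (fun t => Cmult (@?f t) (@?g t)) _ => apply (Ccts_mult f g)
  | |- continuous (fun t => Cplus (@?f t) (@?g t)) _ => apply (Ccts_plus f g)
  | |- continuous (fun t => Cinv (Cpow _ _)) _ => apply Ccts_inv_pow; assumption
  | |- continuous (fun t => Cpow (@?f t) ?n) _ => apply (Ccts_pow f n)
  | |- continuous (fun t => cis t) _ => apply Ccts_cis
  | H : holomorphic ?f |- continuous (fun t => ?f _) _ => apply (Ccts_on_circle f _ _ H)
  | |- continuous (fun t => psum _ _ _) _ => apply Ccts_on_circle, holomorphic_psum
  | H : forall a, continuous ?f a |- continuous ?f _ => apply H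
  | H : forall n a, continuous (?f n) a |- continuous (fun t => ?f _ t) _ => apply H
  end.

Lemma Ci_neq_0 : Ci <> 0%C.
Proof. apply Cmod_gt_0; rewrite Cmod_Ci; lra. Qed.

Lemma orthogonality r m n : 0 < r ->
  Cint (fun a => (r * cis a) ^ m * / (r * cis a) ^ n)%C 0 (2 * PI) =
  if Nat.eq_dec m n then RtoC (2 * PI) else 0%C.
Proof.
intros Hr; assert (Ppi := PI_RGT_0).
destruct (Nat.eq_dec m n) as [-> | N].
- rewrite (Cint_ext _ (fun _ => 1%C)); [| lra |].
  + rewrite Cint_const by lra; rewrite Rminus_0_r; ring.
  + intros a _; field; apply Cpow_nz, circle_neq_0; auto.
- destruct (Nat.lt_total m n) as [H | [H | H]]; [| lia |].
  + rewrite (Cint_ext _ (fun a => (/ (r * cis a)) ^ (n - m))%C); [| lra |].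
    * apply (Cint_exponential_pow _ (- Ci)%C); [| | | lia].
      -- intros E; apply Ci_neq_0; replace Ci with (- (- Ci))%C by ring; rewrite E; ring.
      -- intros t; now apply Cderiv_inv_cis.
      -- now rewrite cis_2PI.
    * intros a _; rewrite Cpow_inv by (now apply circle_neq_0).
      replace n with (m + (n - m))%nat at 1 by lia; rewrite Cpow_add_r.
      field; split; apply Cpow_nz, circle_neq_0; auto.
  + rewrite (Cint_ext _ (fun a => (r * cis a) ^ (m - n))%C); [| lra |].
    * apply (Cint_exponential_pow _ Ci); [apply Ci_neq_0 | | | lia].
      -- intros t.
         replace (Ci * (r * cis t))%C with (0 * cis t + r * (Ci * cis t))%C by ring.
         exact (Cderiv_mult (fun _ => RtoC r) cis t _ _ (Cderiv_const _ t) (Cderiv_cis t)).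
      -- now rewrite cis_2PI.
    * intros a _; replace m with ((m - n) + n)%nat at 1 by lia; rewrite Cpow_add_r.
      field; apply Cpow_nz, circle_neq_0; auto.
Qed.

(** * Taylor expansion of entire functions *)

(** Cauchy's integral for the coefficient of index [n].  The radius is a
    parameter until [taylor_coef_radius] shows that the value does not depend
    on it. *)
Definition taylor_coef (f : C -> C) (r : R) (n : nat) : C :=
  (/ (2 * PI)%R * Cint (fun a => f (r * cis a) * / (r * cis a) ^ n) 0 (2 * PI))%C.

Lemma taylor_coef_bound f r n M : 0 < r -> holomorphic f ->
  (forall a, Cmod (f (r * cis a)%C) <= M) -> Cmod (taylor_coef f r n) <= M / r ^ n.
Proof.
intros Hr Hf HM; assert (Ppi := PI_RGT_0).
unfold taylor_coef; rewrite Cmod_mult, Cmod_inv, Cmod_R, Rabs_pos_eq by (try apply RtoC_neq; lra).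
assert (Pr : 0 < r ^ n) by (now apply pow_lt).
assert (B : Cmod (Cint (fun a => f (r * cis a) * / (r * cis a) ^ n)%C 0 (2 * PI)) <= M / r ^ n * (2 * PI - 0)).
{ apply Cint_bound; [lra | |].
  - intros a _; apply Ccts_mult; [now apply Ccts_on_circle | now apply Ccts_inv_pow].
  - intros a _; rewrite Cmod_mult, Cmod_inv by (apply Cpow_nz, circle_neq_0; auto).
    rewrite Cmod_pow, Cmod_circle by auto.
    apply Rmult_le_compat_r; auto. apply Rlt_le, Rinv_0_lt_compat; auto. }
apply (Rmult_le_compat_l (/ (2 * PI))) in B; [| apply Rlt_le, Rinv_0_lt_compat; lra].
replace (/ (2 * PI) * (M / r ^ n * (2 * PI - 0))) with (M / r ^ n) in B by (field; lra). exact B.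
Qed.

Lemma Cint_psum (F : R -> C) (G : nat -> R -> C) N z :
  (forall a, Ccts F a) -> (forall n a, Ccts (G n) a) ->
  Cint (fun a => F a * psum (fun n => G n a) N z)%C 0 (2 * PI) =
  psum (fun n => Cint (fun a => F a * G n a)%C 0 (2 * PI)) N z.
Proof.
intros HF HG; assert (Ppi := PI_RGT_0).
assert (P : forall n a, Ccts (fun a => psum (fun n => G n a) n z) a).
{ induction n; intros a; simpl; [apply Ccts_const |].
  apply Ccts_plus; auto; apply Ccts_mult; [apply HG | apply Ccts_const]. }
induction N; simpl.
- rewrite (Cint_ext _ (fun _ => 0%C)) by (try lra; intros; ring). rewrite Cint_const by lra; ring.
- rewrite (Cint_ext _ (fun a => F a * psum (fun n => G n a) N z + z ^ N * (F a * G N a))%C) by (try lra; intros; ring).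
  rewrite Cint_plus, Cint_scal, IHN; try lra; [ring | | |]; ccts.
  apply P.
Qed.

Lemma taylor_coef_minus f g r n : 0 < r -> holomorphic f -> holomorphic g ->
  taylor_coef (fun z => f z - g z)%C r n = (taylor_coef f r n - taylor_coef g r n)%C.
Proof.
intros Hr Hf Hg; assert (Ppi := PI_RGT_0); unfold taylor_coef.
rewrite (Cint_ext _ (fun a => f (r * cis a) * / (r * cis a) ^ n + (-1) * (g (r * cis a) * / (r * cis a) ^ n))%C)
  by (try lra; intros; ring).
rewrite Cint_plus, Cint_scal; try lra; [ring | | |]; ccts.
Qed.

(** Orthogonality of the powers: the coefficients of a polynomial are
    recovered from its values on any circle. *)
Lemma taylor_coef_psum (b : nat -> C) N r n : 0 < r ->
  taylor_coef (psum b N) r n = if lt_dec n N then b n else 0%C.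
Proof.
intros Hr; assert (Ppi := PI_RGT_0).
assert (P : RtoC (2 * PI) <> 0%C) by (apply RtoC_neq; lra).
induction N; unfold taylor_coef; simpl.
- rewrite (Cint_ext _ (fun _ => 0%C)) by (try lra; intros; ring). rewrite Cint_const by lra; ring.
- rewrite (Cint_ext _ (fun a => psum b N (r * cis a) * / (r * cis a) ^ n + b N * ((r * cis a) ^ N * / (r * cis a) ^ n))%C)
    by (try lra; intros; ring).
  rewrite Cint_plus, Cint_scal; try lra; ccts.
  unfold taylor_coef in IHN; rewrite Cmult_plus_distr_l, IHN, orthogonality by auto.
  destruct (lt_dec n N), (lt_dec n (S N)), (Nat.eq_dec N n); try lia; subst; try ring; field; auto.
Qed.

Lemma le_geometric_nonpos x K y : 0 <= x < 1 ->
  (forall N : nat, (0 < N)%nat -> y <= K * x ^ N) -> y <= 0.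
Proof.
intros Hx Hy; apply le_epsilon; intros e He.
destruct (pow_lt_1_zero x) with (y := e / (Rabs K + 1)) as [N HN].
- rewrite Rabs_pos_eq; lra.
- apply Rdiv_lt_0_compat; auto; generalize (Rabs_pos K); lra.
- specialize (HN (S N) ltac:(lia)); rewrite Rabs_pos_eq in HN by (apply pow_le; lra).
  eapply Rle_trans; [apply (Hy (S N)); lia |].
  assert (HK := Rle_abs K); assert (PK := Rabs_pos K).
  assert (Px : 0 <= x ^ S N) by (apply pow_le; lra).
  apply (Rmult_lt_compat_l (Rabs K + 1)) in HN; [| lra].
  replace ((Rabs K + 1) * (e / (Rabs K + 1))) with e in HN by (field; lra). nra.
Qed.

(** Keeping the exact remainder makes all later expansions finite sums. *)
Lemma geometric_expansion (z w : C) N : w <> 0%C -> (w - z)%C <> 0%C ->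
  (w * / (w - z) = psum (fun n => / w ^ n) N z + z ^ N * (/ w ^ N * (w * / (w - z))))%C.
Proof.
intros Hw Hz; assert (P : forall n, (w ^ n)%C <> 0%C) by (intros; now apply Cpow_nz).
induction N; simpl.
- field; auto.
- rewrite IHN at 1. field; auto.
Qed.

Lemma Cdiff_inv_shift (z w : C) : w <> z -> exists l, Cdiff (fun w => / (w - z))%C w l.
Proof.
intros Hw; exists (- / ((w - z) * (w - z)))%C; intros eta He.
assert (Hwz : (w - z)%C <> 0%C).
{ intros E; apply Hw; replace w with (w - z + z)%C by ring; rewrite E; ring. }
destruct (Cdiff_inv _ Hwz eta He) as [d [Hd1 Hd2]]; exists d; split; auto.
intros v Hv; specialize (Hd2 (v - z)%C).
replace (v - z - (w - z))%C with (v - w)%C in Hd2 by ring; auto.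
Qed.

(** [dw / (w - z) = i cauchy_kernel da] for [w = r cis a]. *)
Definition cauchy_kernel (z : C) (r a : R) : C := (r * cis a * / (r * cis a - z))%C.

Lemma Ccts_cauchy_kernel z r a : Cmod z < r -> Ccts (cauchy_kernel z r) a.
Proof.
intros Hz; destruct (Cdiff_inv_shift z (r * cis a)%C) as [l Hl].
- intros E; assert (S := spoke_bounds z r a Hz); rewrite E in S.
  replace (z - z)%C with (RtoC 0) in S by ring; rewrite Cmod_0 in S; lra.
- apply Ccts_mult; [apply Ccts_circle |].
  exact (Ccts_comp_diff (fun w => / (w - z))%C l (fun a => r * cis a)%C a Hl (Ccts_circle r a)).
Qed.

Lemma cauchy_kernel_bound z r a : Cmod z < r -> Cmod (cauchy_kernel z r a) <= r / (r - Cmod z).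
Proof.
intros Hz; assert (P := Cmod_ge_0 z); assert (S := spoke_bounds z r a Hz).
assert (T := Cmod_triangle (r * cis a - z) z).
replace (r * cis a - z + z)%C with (r * cis a)%C in T by ring.
rewrite Cmod_circle in T by lra.
unfold cauchy_kernel; rewrite Cmod_mult, Cmod_inv, Cmod_circle by (lra || (apply Cmod_gt_0; lra)).
apply Rmult_le_compat_l; [lra |]; apply Rinv_le_contravar; lra.
Qed.

(** The difference quotient [(f w - f z) / (w - z)] is differentiable for
    [w <> z] and bounded near [z], so [circle_integral_vanishes] applies to
    it. *)
Lemma cauchy_formula f z r : holomorphic f -> Cmod z < r ->
  Cint (fun a => f (r * cis a) * cauchy_kernel z r a)%C 0 (2 * PI) =
  (f z * Cint (cauchy_kernel z r) 0 (2 * PI))%C.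
Proof.
intros Hf Hz; assert (Ppi := PI_RGT_0).
assert (Hc : forall a, Ccts (cauchy_kernel z r) a) by (intros; now apply Ccts_cauchy_kernel).
set (g := fun w => ((f w + - f z) * / (w - z))%C).
assert (V : Cint (fun a => g (r * cis a) * (r * cis a))%C 0 (2 * PI) = 0%C).
{ apply (circle_integral_vanishes g z r Hz).
  - intros w Hw; destruct (Hf w) as [l Hl].
    destruct (Cdiff_inv_shift z w Hw) as [m Hm].
    eexists; apply Cdiff_mult; [apply Cdiff_plus; [exact Hl | apply Cdiff_const] | exact Hm].
  - destruct (Hf z) as [l Hl]; destruct (Cdiff_lipschitz _ _ _ Hl) as [d [Hd1 Hd2]].
    exists d, (1 + Cmod l); split; auto; intros w [H1 H2].
    assert (Hwz : (w - z)%C <> 0%C) by (now apply Cmod_gt_0).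
    unfold g; rewrite Cmod_mult, Cmod_inv by auto.
    apply (Rmult_le_reg_r (Cmod (w - z))); auto.
    rewrite Rmult_assoc, Rinv_l, Rmult_1_r by lra. exact (Hd2 w H2). }
rewrite <- Cint_scal by (try lra; intros a _; apply Hc).
rewrite (Cint_ext _ (fun a => g (r * cis a) * (r * cis a) + f z * cauchy_kernel z r a)%C);
  [| lra | intros a _; unfold g, cauchy_kernel; ring].
rewrite Cint_plus; [rewrite V; ring | lra | |].
- intros a _. apply (continuous_ext (fun a => (f (r * cis a) + - f z) * cauchy_kernel z r a)%C).
  + intros b; match goal with |- ?x = ?y => change (@eq C x y) end; unfold g, cauchy_kernel; ring.
  + apply Ccts_mult; auto; apply Ccts_plus; [now apply Ccts_on_circle | apply Ccts_const].
- intros a _; apply Ccts_mult; [apply Ccts_const | auto].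
Qed.

Lemma psum_ext a b N z : (forall n, (n < N)%nat -> a n = b n) -> psum a N z = psum b N z.
Proof.
intros H; induction N; simpl; auto.
rewrite H, IHN by (intros; try apply H; lia); auto.
Qed.

Lemma psum_scal c a N z : psum (fun n => c * a n)%C N z = (c * psum a N z)%C.
Proof. induction N; simpl; [ring | rewrite IHN; ring]. Qed.

Lemma cauchy_kernel_expansion (F : R -> C) z r N : Cmod z < r -> (forall a, Ccts F a) ->
  Cint (fun a => F a * cauchy_kernel z r a)%C 0 (2 * PI) =
  (psum (fun n => Cint (fun a => F a * / (r * cis a) ^ n)%C 0 (2 * PI)) N z +
   z ^ N * Cint (fun a => F a * (/ (r * cis a) ^ N * cauchy_kernel z r a)) 0 (2 * PI))%C.
Proof.
intros Hz HF; assert (Ppi := PI_RGT_0).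
assert (Hr : 0 < r) by (generalize (Cmod_ge_0 z); lra).
assert (Hc : forall a, Ccts (cauchy_kernel z r) a) by (intros; now apply Ccts_cauchy_kernel).
assert (Hi : forall n a, Ccts (fun a => / (r * cis a) ^ n)%C a) by (intros; now apply Ccts_inv_pow).
rewrite <- (Cint_psum F (fun n a => / (r * cis a) ^ n)%C) by auto.
rewrite <- Cint_scal; [| lra | ccts].
assert (Hp : forall n a, Ccts (fun a => psum (fun n => / (r * cis a) ^ n)%C n z) a).
{ induction n; intros a; simpl; [apply Ccts_const |]; apply Ccts_plus; auto; ccts. }
rewrite <- Cint_plus; [| lra | | ccts].
- apply Cint_ext; [lra |]; intros a _.
  unfold cauchy_kernel at 1; rewrite (geometric_expansion z (r * cis a) N); [| now apply circle_neq_0 |].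
  + unfold cauchy_kernel; ring.
  + apply Cmod_gt_0; now apply spoke_bounds.
- intros a _; apply Ccts_mult; [apply HF | apply Hp].
Qed.

Lemma kernel_remainder_bound (F : R -> C) z r N M : Cmod z < r -> (forall a, Ccts F a) ->
  (forall a, Cmod (F a) <= M) ->
  Cmod (z ^ N * Cint (fun a => F a * (/ (r * cis a) ^ N * cauchy_kernel z r a)) 0 (2 * PI))%C
  <= 2 * PI * (M * (r / (r - Cmod z))) * (Cmod z / r) ^ N.
Proof.
intros Hz HF HM; assert (Ppi := PI_RGT_0).
assert (Hr : 0 < r) by (generalize (Cmod_ge_0 z); lra).
assert (Hc : forall a, Ccts (cauchy_kernel z r) a) by (intros; now apply Ccts_cauchy_kernel).
assert (Pr : 0 < / r ^ N) by (apply Rinv_0_lt_compat; now apply pow_lt).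
assert (B : Cmod (Cint (fun a => F a * (/ (r * cis a) ^ N * cauchy_kernel z r a))%C 0 (2 * PI))
  <= M * (/ r ^ N * (r / (r - Cmod z))) * (2 * PI - 0)).
{ apply Cint_bound; [lra | ccts |].
  intros a _; rewrite !Cmod_mult, Cmod_inv, Cmod_pow, Cmod_circle by (auto; apply Cpow_nz, circle_neq_0; auto).
  apply Rmult_le_compat; auto using Cmod_ge_0.
  - apply Rmult_le_pos; [lra | apply Cmod_ge_0].
  - apply Rmult_le_compat_l; [lra |]; now apply cauchy_kernel_bound. }
rewrite Cmod_mult, Cmod_pow.
eapply Rle_trans; [apply Rmult_le_compat_l; [apply pow_le, Cmod_ge_0 | exact B] |].
apply Req_le; unfold Rdiv; rewrite Rpow_mult_distr, pow_inv; ring.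
Qed.

(** Expanded to order [N], only the term of index [0] has a nonzero integral,
    and the remainder is [O ((|z| / r) ^ N)] for every [N]. *)
Lemma Cint_cauchy_kernel z r : Cmod z < r -> Cint (cauchy_kernel z r) 0 (2 * PI) = RtoC (2 * PI).
Proof.
intros Hz; assert (Ppi := PI_RGT_0); assert (Pz := Cmod_ge_0 z).
replace (Cint (cauchy_kernel z r) 0 (2 * PI)) with
  (Cint (cauchy_kernel z r) 0 (2 * PI) - RtoC (2 * PI) + RtoC (2 * PI))%C by ring.
replace (Cint (cauchy_kernel z r) 0 (2 * PI) - RtoC (2 * PI))%C with (RtoC 0); [ring |].
symmetry; apply Cmod_eq_0, Rle_antisym; [| apply Cmod_ge_0].
apply (le_geometric_nonpos (Cmod z / r) (2 * PI * (1 * (r / (r - Cmod z))))).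
- split; [apply Rmult_le_pos; [lra |]; apply Rlt_le, Rinv_0_lt_compat; lra |].
  apply Rlt_div_l; lra.
- intros N HN.
  assert (H1 : forall a, Ccts (fun a => (r * cis a) ^ 0)%C a) by (intros; simpl; apply Ccts_const).
  rewrite (Cint_ext _ (fun a => (r * cis a) ^ 0 * cauchy_kernel z r a)%C) by (try lra; intros; simpl; ring).
  rewrite (cauchy_kernel_expansion _ z r N Hz H1).
  rewrite (psum_ext _ (fun n => if Nat.eq_dec 0 n then RtoC (2 * PI) else 0%C))
    by (intros n _; apply orthogonality; lra).
  assert (S : psum (fun n => if Nat.eq_dec 0 n then RtoC (2 * PI) else 0%C) N z = RtoC (2 * PI)).
  { destruct N as [| N]; [lia | clear HN].
    induction N; [simpl; ring |]. cbn [psum] in *; rewrite IHN; simpl; ring. }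
  rewrite S.
  match goal with |- Cmod (?a + ?b - ?a) <= _ => replace (a + b - a)%C with b by ring end.
  apply kernel_remainder_bound; auto.
  intros a; simpl; rewrite Cmod_1; lra.
Qed.

Lemma taylor_remainder f z r N M : holomorphic f -> Cmod z < r ->
  (forall a, Cmod (f (r * cis a)%C) <= M) ->
  Cmod (f z - psum (taylor_coef f r) N z) <= M * (r / (r - Cmod z)) * (Cmod z / r) ^ N.
Proof.
intros Hf Hz HM; assert (Ppi := PI_RGT_0).
assert (P : RtoC (2 * PI) <> 0%C) by (apply RtoC_neq; lra).
assert (HF : forall a, Ccts (fun a => f (r * cis a)%C) a) by (intros; now apply Ccts_on_circle).
assert (E := cauchy_formula f z r Hf Hz); rewrite Cint_cauchy_kernel in E by auto.
rewrite (cauchy_kernel_expansion _ z r N Hz HF) in E.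
assert (B := kernel_remainder_bound _ z r N M Hz HF HM).
match type of B with Cmod ?e <= _ => set (rem := e) in * end.
assert (E2 : (f z - psum (taylor_coef f r) N z)%C = (/ RtoC (2 * PI) * rem)%C).
{ unfold taylor_coef; rewrite psum_scal.
  replace (f z) with (/ RtoC (2 * PI) * (f z * RtoC (2 * PI)))%C by (field; auto).
  rewrite <- E; ring. }
rewrite E2, Cmod_mult, Cmod_inv, Cmod_R, Rabs_pos_eq by (auto; lra).
apply (Rmult_le_compat_l (/ (2 * PI))) in B; [| apply Rlt_le, Rinv_0_lt_compat; lra].
eapply Rle_trans; [exact B |]; apply Req_le; rewrite !Rmult_assoc, <- (Rmult_assoc 2), <- Rmult_assoc.
rewrite Rinv_l by lra; ring.
Qed.

(** On the smaller circle [f] is its Taylor polynomial for the larger radius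
    up to [O ((s / r) ^ N)].  Taking coefficients for the radius [s] of both
    sides, the polynomial returns its own coefficients, and [N] is
    arbitrary. *)
Lemma taylor_coef_radius f s r n M : holomorphic f -> 0 < s < r ->
  (forall z, Cmod z <= r -> Cmod (f z) <= M) -> taylor_coef f s n = taylor_coef f r n.
Proof.
intros Hf Hs HM.
assert (E : Cmod (taylor_coef f s n - taylor_coef f r n) <= 0).
{ apply (le_geometric_nonpos (s / r) (M * (r / (r - s)) / s ^ n * (s / r) ^ n)).
  - split; [apply Rmult_le_pos; [lra |]; apply Rlt_le, Rinv_0_lt_compat; lra |].
    apply Rlt_div_l; lra.
  - intros N HN.
    assert (HP := holomorphic_psum (taylor_coef f r) (n + N)).
    replace (taylor_coef f r n) with (taylor_coef (psum (taylor_coef f r) (n + N)) s n).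
    + rewrite <- taylor_coef_minus by (auto; lra).
      replace (M * (r / (r - s)) / s ^ n * (s / r) ^ n * (s / r) ^ N) with
        (M * (r / (r - s)) * (s / r) ^ (n + N) / s ^ n) by (rewrite pow_add; unfold Rdiv; ring).
      apply taylor_coef_bound; [lra | |].
      * intros z; destruct (Hf z) as [l Hl]; destruct (HP z) as [m Hm].
        eexists; apply (Cdiff_plus f (fun z => - psum (taylor_coef f r) (n + N) z)%C); [exact Hl |].
        intros eta He; destruct (Hm eta He) as [d [Hd1 Hd2]]; exists d; split; auto; intros w Hw.
        replace (- psum (taylor_coef f r) (n + N) w - - psum (taylor_coef f r) (n + N) z - - m * (w - z))%C
          with (- (psum (taylor_coef f r) (n + N) w - psum (taylor_coef f r) (n + N) z - m * (w - z)))%C by ring.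
        rewrite Cmod_opp; auto.
      * intros a; rewrite <- (Cmod_circle s a) at 3 4 by lra.
        apply taylor_remainder; auto; [rewrite Cmod_circle; lra |].
        intros b; apply HM; rewrite Cmod_circle; lra.
    + rewrite taylor_coef_psum by lra; destruct (lt_dec n (n + N)); auto; lia. }
assert (Z : (taylor_coef f s n - taylor_coef f r n)%C = 0%C).
{ apply Cmod_eq_0, Rle_antisym; auto using Cmod_ge_0. }
replace (taylor_coef f s n) with (taylor_coef f s n - taylor_coef f r n + taylor_coef f r n)%C by ring.
rewrite Z; ring.
Qed.

(** * Coefficients of functions of exponential type *)

(** [exp (- phi A n) = (e A / n) ^ n] is the minimum over [r > 0] of
    [exp (A r) / r ^ n], and it has the right limit value [1] at [n = 0]. *)
Definition phi (A t : R) : R := t * (ln (t / A) - 1).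

Lemma exp_phi A n : 0 < A -> 0 < n -> exp (- phi A n) = exp n * exp (- (n * ln (n / A))).
Proof. intros; rewrite <- exp_plus; f_equal; unfold phi; ring. Qed.

Lemma exp_nat_ln x n : 0 < x -> exp (INR n * ln x) = x ^ n.
Proof. intros Hx; rewrite <- Rpower_pow by auto; reflexivity. Qed.

(** With [u = A r / n] the claim is [1 + ln u <= u], raised to the power
    [n]. *)
Lemma exp_phi_optimal A (n : nat) r : 0 < A -> 0 <= r -> exp (- phi A (INR n)) * r ^ n <= exp (A * r).
Proof.
intros HA Hr; destruct n as [| n].
- unfold phi; simpl; rewrite Rmult_0_l, Ropp_0, exp_0, Rmult_1_l.
  rewrite <- exp_0; destruct (Req_dec (A * r) 0) as [-> | H]; [lra |].
  apply Rlt_le, exp_increasing; assert (0 <= A * r) by (apply Rmult_le_pos; lra); lra.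
- set (k := INR (S n)); assert (Hk : 0 < k) by (apply lt_0_INR; lia).
  destruct (Req_dec r 0) as [-> | H].
  { rewrite pow_i by lia; rewrite Rmult_0_r; apply Rlt_le, exp_pos. }
  assert (Hr' : 0 < r) by lra.
  rewrite <- (exp_nat_ln r) by auto; fold k; rewrite <- exp_plus.
  assert (L : ln (A * r / k) <= A * r / k - 1).
  { assert (P : 0 < A * r / k) by (apply Rdiv_lt_0_compat; auto; now apply Rmult_lt_0_compat).
    assert (E := exp_ineq1_le (ln (A * r / k))); rewrite exp_ln in E by auto; lra. }
  assert (E : ln (A * r / k) = ln r - ln (k / A)).
  { unfold Rdiv; rewrite !ln_mult, !ln_Rinv; auto; try lra;
     try (apply Rinv_0_lt_compat; auto); now apply Rmult_lt_0_compat. }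
  rewrite E in L; apply (Rmult_le_compat_l k) in L; [| lra].
  replace (k * (A * r / k - 1)) with (A * r - k) in L by (field; lra).
  assert (X : - phi A k + k * ln r <= A * r) by (unfold phi; lra).
  destruct X as [X | X]; [apply Rlt_le, exp_increasing; auto | rewrite X; lra].
Qed.

Lemma F_exp_holomorphic A B f : F_exp A B f -> holomorphic f.
Proof. intros [H _] z; destruct (H z I) as [l Hl]; exists l; now apply Cdiff_iff. Qed.

Lemma F_exp_on_circle A B f r a : 0 < r -> F_exp A B f -> Cmod (f (r * cis a)%C) <= B * exp (A * r).
Proof. intros Hr [_ H]; specialize (H (r * cis a)%C); now rewrite Cmod_circle in H. Qed.

Lemma exp_le x y : x <= y -> exp x <= exp y.
Proof. intros [H | ->]; [apply Rlt_le, exp_increasing; auto | lra]. Qed.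

Lemma F_exp_coef_radius A B f r s n : 0 < A -> 0 < B -> F_exp A B f -> 0 < r -> 0 < s ->
  taylor_coef f r n = taylor_coef f s n.
Proof.
intros HA HB Hf Hr Hs.
assert (K : forall r s, 0 < r < s -> taylor_coef f r n = taylor_coef f s n).
{ intros r' s' H; apply (taylor_coef_radius f r' s' n (B * exp (A * s'))); auto.
  - now apply (F_exp_holomorphic A B).
  - intros z Hz; destruct Hf as [_ Hf]; eapply Rle_trans; [apply Hf |].
    apply Rmult_le_compat_l; [lra |]; apply exp_le, Rmult_le_compat_l; lra. }
destruct (Rtotal_order r s) as [H | [-> | H]]; auto. symmetry; auto.
Qed.

(** Cauchy's estimate at the optimal radius [n / A].  There is no such radius for
    [n = 0]; radius [1] is used there, at the price of the factor [exp A],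
    which is kept for all [n] to have a single formula. *)
Lemma F_exp_coef_bound A B f n : 0 < A -> 0 < B -> F_exp A B f ->
  Cmod (taylor_coef f 1 n) <= B * exp A * exp (- phi A (INR n)).
Proof.
intros HA HB Hf; assert (Hh := F_exp_holomorphic A B f Hf).
destruct n as [| n].
- assert (H := taylor_coef_bound f 1 0 (B * exp (A * 1)) Rlt_0_1 Hh).
  eapply Rle_trans; [apply H; intros a; apply F_exp_on_circle; auto; lra |].
  unfold phi; simpl; rewrite Rmult_0_l, Ropp_0, exp_0, Rmult_1_r; apply Req_le; field.
- set (k := INR (S n)); assert (Hk : 0 < k) by (apply lt_0_INR; lia).
  assert (Hr : 0 < k / A) by (now apply Rdiv_lt_0_compat).
  rewrite (F_exp_coef_radius A B f 1 (k / A)) by (auto; lra).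
  eapply Rle_trans; [apply (taylor_coef_bound f (k / A) (S n) (B * exp (A * (k / A)))); auto |].
  + intros a; now apply F_exp_on_circle.
  + replace (A * (k / A)) with k by (field; lra).
    rewrite exp_phi by auto; rewrite exp_Ropp.
    replace (exp (k * ln (k / A))) with ((k / A) ^ S n) by (symmetry; apply exp_nat_ln; exact Hr).
    assert (1 <= exp A) by (rewrite <- exp_0; apply exp_le; lra).
    assert (P : 0 < B * (exp k * / (k / A) ^ S n)).
    { repeat apply Rmult_lt_0_compat; auto using exp_pos.
      apply Rinv_0_lt_compat, pow_lt; exact Hr. }
    replace (B * exp A * (exp k * / (k / A) ^ S n)) with (exp A * (B * (exp k * / (k / A) ^ S n))) by ring.
    replace (B * exp k / (k / A) ^ S n) with (B * (exp k * / (k / A) ^ S n)) by (unfold Rdiv; ring).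
    nra.
Qed.

(** The Taylor remainder at the optimal radius [N / A]; as this radius is at
    least [2], the geometric factor is at most [2]. *)
Lemma F_exp_tail A B f N z : 0 < A -> 0 < B -> F_exp A B f -> (0 < N)%nat -> 2 * A <= INR N ->
  Cmod z < 1 -> Cmod (f z - psum (taylor_coef f 1) N z) <= 2 * B * exp (- phi A (INR N)).
Proof.
intros HA HB Hf HN HN2 Hz; assert (Hh := F_exp_holomorphic A B f Hf).
assert (Hk : 0 < INR N) by (apply lt_0_INR; lia); set (r := INR N / A).
assert (Hr : 2 <= r) by (unfold r; apply Rle_div_r; lra).
rewrite (psum_ext _ (taylor_coef f r)) by (intros; apply (F_exp_coef_radius A B); auto; lra).
assert (Pz := Cmod_ge_0 z).
eapply Rle_trans; [apply (taylor_remainder f z r N (B * exp (A * r))); auto; [lra |] |].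
- intros a; apply F_exp_on_circle; auto; lra.
- replace (A * r) with (INR N) by (unfold r; field; lra).
  rewrite exp_phi by auto; rewrite exp_Ropp; fold r; rewrite exp_nat_ln by lra.
  assert (H1 : r / (r - Cmod z) <= 2) by (apply Rle_div_l; lra).
  assert (H0 : 0 <= r / (r - Cmod z)) by (apply Rlt_le, Rdiv_lt_0_compat; lra).
  assert (H2 : (Cmod z / r) ^ N <= / r ^ N).
  { rewrite <- pow_inv; apply pow_incr; split.
    - apply Rmult_le_pos; auto; apply Rlt_le, Rinv_0_lt_compat; lra.
    - unfold Rdiv; assert (0 < / r) by (apply Rinv_0_lt_compat; lra); nra. }
  assert (H3 : 0 <= (Cmod z / r) ^ N).
  { apply pow_le, Rmult_le_pos; auto; apply Rlt_le, Rinv_0_lt_compat; lra. }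
  assert (PB : 0 < B * exp (INR N)) by (apply Rmult_lt_0_compat; auto using exp_pos).
  replace (2 * B * (exp (INR N) * / r ^ N)) with (B * exp (INR N) * (2 * / r ^ N)) by ring.
  rewrite Rmult_assoc; apply Rmult_le_compat_l; [lra |].
  apply Rmult_le_compat; auto.
Qed.

(** * Finite families of polynomials *)

Fixpoint rsum (f : nat -> R) (N : nat) : R :=
  match N with O => 0 | S n => rsum f n + f n end.

Lemma rsum_le f g N : (forall n, (n < N)%nat -> f n <= g n) -> rsum f N <= rsum g N.
Proof.
intros H; induction N; simpl; [lra |].
apply Rplus_le_compat; [apply IHN; intros; apply H | apply H]; lia.
Qed.

Lemma rsum_const c N : rsum (fun _ => c) N = INR N * c.
Proof. induction N; [simpl; ring |]. rewrite S_INR; simpl; rewrite IHN; ring. Qed.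

Lemma rsum_plus f g N : rsum (fun n => f n + g n) N = rsum f N + rsum g N.
Proof. induction N; simpl; [ring | rewrite IHN; ring]. Qed.

Lemma rsum_scal c f N : rsum (fun n => c * f n) N = c * rsum f N.
Proof. induction N; simpl; [ring | rewrite IHN; ring]. Qed.

(** The polynomials whose coefficient of index [n] is taken in the list
    [G n], listed as functions because these are the points of the metric
    space. *)
Fixpoint polys (G : nat -> list C) (N : nat) : list (C -> C) :=
  match N with
  | O => (fun _ => RtoC 0) :: nil
  | S n => map (fun pc z => (fst pc z + snd pc * z ^ n)%C) (list_prod (polys G n) (G n))
  end.

Lemma in_polys G N p : In p (polys G N) <-> exists b, (forall n, (n < N)%nat -> In (b n) (G n)) /\ p = psum b N.
Proof.
revert p; induction N; intros p; simpl.
- split.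
  + intros [<- | []]; exists (fun _ => RtoC 0); split; [lia | reflexivity].
  + intros [b [_ ->]]; left; reflexivity.
- rewrite in_map_iff; split.
  + intros [[q c] [<- H]]; apply in_prod_iff in H as [Hq Hc]; apply IHN in Hq as [b [Hb ->]].
    exists (fun n => if Nat.eq_dec n N then c else b n); split.
    * intros n Hn; destruct (Nat.eq_dec n N) as [-> |]; auto; apply Hb; lia.
    * apply functional_extensionality; intros z; simpl.
      destruct (Nat.eq_dec N N); [| lia]; f_equal.
      apply psum_ext; intros n Hn; destruct (Nat.eq_dec n N); auto; lia.
  + intros [b [Hb ->]]; exists (psum b N, b N); split; [reflexivity |].
    apply in_prod_iff; split; [apply IHN; exists b; split; auto | apply Hb; lia].
Qed.

Lemma ln_length_polys G N : (forall n, (n < N)%nat -> (0 < length (G n))%nat) ->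
  (0 < length (polys G N))%nat /\ ln (INR (length (polys G N))) = rsum (fun n => ln (INR (length (G n)))) N.
Proof.
intros H; induction N; cbn [polys rsum].
- simpl; rewrite ln_1; split; [lia | reflexivity].
- destruct IHN as [H1 H2]; [intros; apply H; lia |].
  assert (H3 := H N ltac:(lia)).
  rewrite length_map, length_prod; split; [nia |].
  rewrite mult_INR, ln_mult, H2 by (apply lt_0_INR; auto); reflexivity.
Qed.

(** The coefficients are Cauchy integrals, hence determined by the
    function. *)
Lemma psum_coef_unique b b' N : psum b N = psum b' N -> forall n, (n < N)%nat -> b n = b' n.
Proof.
intros E n Hn; assert (H := taylor_coef_psum b N 1 n Rlt_0_1); rewrite E, taylor_coef_psum in H by lra.
destruct (lt_dec n N); [auto | lia].
Qed.

Lemma NoDup_list_prod {X Y : Type} (l : list X) (l' : list Y) : NoDup l -> NoDup l' -> NoDup (list_prod l l').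
Proof.
intros Hl Hl'; induction Hl as [| a l Ha Hl IH]; simpl; [constructor |].
apply NoDup_app; auto.
- apply Injective_map_NoDup; auto; intros x y E; congruence.
- intros [x y] H1 H2; apply in_map_iff in H1 as [y' [E _]]; apply in_prod_iff in H2 as [H2 _].
  congruence.
Qed.

(** The number of functions obtained is really the product of the lengths,
    because a polynomial function determines its coefficients. *)
Lemma NoDup_polys G N : (forall n, (n < N)%nat -> NoDup (G n)) -> NoDup (polys G N).
Proof.
intros H; induction N; simpl; [repeat constructor; auto |].
apply Injective_map_NoDup_in; [| apply NoDup_list_prod; auto].
intros [p c] [q d] Hp Hq E; apply in_prod_iff in Hp as [Hp _]; apply in_prod_iff in Hq as [Hq _].
apply in_polys in Hp as [b [_ ->]]; apply in_polys in Hq as [b' [_ ->]].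
assert (U := psum_coef_unique (fun n => if Nat.eq_dec n N then c else b n)
  (fun n => if Nat.eq_dec n N then d else b' n) (S N)).
assert (X : forall b c, psum (fun n => if Nat.eq_dec n N then c else b n) (S N) = (fun z => psum b N z + c * z ^ N)%C).
{ intros b0 c0; apply functional_extensionality; intros z; simpl.
  destruct (Nat.eq_dec N N); [| lia]; f_equal.
  apply psum_ext; intros n Hn; destruct (Nat.eq_dec n N); auto; lia. }
rewrite !X in U; specialize (U E); f_equal.
- apply functional_extensionality; intros z; apply psum_ext; intros n Hn.
  specialize (U n ltac:(lia)); simpl in U; destruct (Nat.eq_dec n N); [lia | auto].
- specialize (U N ltac:(lia)); simpl in U; destruct (Nat.eq_dec N N); [auto | lia].
Qed.

(** * The supremum distance on the disk *)

Lemma d1_le f g e : (forall z, Cmod z < 1 -> Cmod (f z - g z) <= e) -> Defs.d1 f g <= e.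
Proof.
intros H; unfold Defs.d1.
set (E := fun r => exists z, unit_disk z /\ r = Cmod (f z - g z)%C).
assert (U := Lub_Rbar_correct E); destruct U as [U1 U2].
assert (L : Rbar_le (Lub_Rbar E) e) by (apply U2; intros x [z [Hz ->]]; now apply H).
assert (Z : E (Cmod (f 0 - g 0)%C)) by (exists 0%C; split; auto; unfold unit_disk; rewrite Cmod_0; lra).
specialize (U1 _ Z); destruct (Lub_Rbar E); simpl in *; auto; tauto.
Qed.

(** The bound [M] ensures that the supremum is finite, so that it is not
    replaced by a default value. *)
Lemma d1_ge f g M z : (forall z, Cmod z < 1 -> Cmod (f z - g z) <= M) -> Cmod z < 1 ->
  Cmod (f z - g z) <= Defs.d1 f g.
Proof.
intros H Hz; unfold Defs.d1.
set (E := fun r => exists z, unit_disk z /\ r = Cmod (f z - g z)%C).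
assert (U := Lub_Rbar_correct E); destruct U as [U1 U2].
assert (L : Rbar_le (Lub_Rbar E) M) by (apply U2; intros x [w [Hw ->]]; now apply H).
assert (Z : E (Cmod (f z - g z)%C)) by (exists z; split; auto).
specialize (U1 _ Z); destruct (Lub_Rbar E); simpl in *; auto; tauto.
Qed.

Lemma psum_norm b N z e : Cmod z <= 1 -> (forall n, (n < N)%nat -> Cmod (b n) <= e) -> 
  Cmod (psum b N z) <= INR N * e.
Proof.
intros Hz H; induction N; [simpl; rewrite Cmod_0; lra |].
rewrite S_INR; simpl; eapply Rle_trans; [apply Cmod_triangle |].
rewrite Cmod_mult, Cmod_pow.
assert (Cmod z ^ N <= 1) by (rewrite <- (pow1 N); apply pow_incr; split; auto using Cmod_ge_0).
assert (0 <= Cmod z ^ N) by (apply pow_le, Cmod_ge_0).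
assert (HbN := H N ltac:(lia)); assert (PbN := Cmod_ge_0 (b N)).
assert (IH := IHN ltac:(intros; apply H; lia)).
nra.
Qed.

Lemma psum_minus a b N z : (psum a N z - psum b N z = psum (fun n => a n - b n)%C N z)%C.
Proof. induction N; simpl; [ring | rewrite <- IHN; ring]. Qed.

Lemma psum_analytic b N : bounded_analytic_on_disk (psum b N).
Proof.
split.
- intros z _; destruct (holomorphic_psum b N z) as [l Hl]; exists l; now apply Cdiff_iff.
- assert (X : exists e, forall n, (n < N)%nat -> Cmod (b n) <= e).
  { clear; induction N as [| N [e He]]; [exists 0; lia |].
    exists (Rmax e (Cmod (b N))); intros n Hn; destruct (Nat.eq_dec n N) as [-> |]; [apply Rmax_r |].
    eapply Rle_trans; [apply He; lia | apply Rmax_l]. }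
  destruct X as [e He]; exists (INR N * e); intros z Hz; apply psum_norm; auto; now apply Rlt_le.
Qed.

(** * Coverings and packings by grid polynomials *)

(** A [J] by [J] grid of mesh [s]; the offset [K] centres it at the origin
    when [J = 2 K + 1], and puts it in the first quadrant when [K = 0]. *)
Definition square_grid (s : R) (J K : nat) : list C :=
  map (fun jk => ((s * (INR (fst jk) - INR K)), (s * (INR (snd jk) - INR K))))
    (list_prod (seq 0 J) (seq 0 J)).

Lemma length_square_grid s J K : length (square_grid s J K) = (J * J)%nat.
Proof. unfold square_grid; now rewrite length_map, length_prod, length_seq. Qed.

Lemma NoDup_square_grid s J K : 0 < s -> NoDup (square_grid s J K).
Proof.
intros Hs; apply Injective_map_NoDup; [| apply NoDup_list_prod; apply seq_NoDup].
intros [j k] [j' k'] E; injection E as E1 E2; simpl in *.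
apply Rmult_eq_reg_l in E1; [| lra]; apply Rmult_eq_reg_l in E2; [| lra].
f_equal; apply INR_eq; lra.
Qed.

Lemma nat_ceil x : 0 <= x -> exists n : nat, x < INR n <= x + 1.
Proof.
intros Hx; destruct (archimed x) as [H1 H2]; exists (Z.to_nat (up x)).
rewrite INR_IZR_INZ, Z2Nat.id; [lra |].
apply le_IZR; lra.
Qed.

Lemma square_grid_covers s K c : 0 < s -> Cmod c <= s * INR K ->
  exists c', In c' (square_grid s (2 * K + 1) K) /\ Cmod (c - c') <= 2 * s.
Proof.
intros Hs Hc.
assert (X : forall x, Rabs x <= s * INR K -> exists j, (j < 2 * K + 1)%nat /\ Rabs (x - s * (INR j - INR K)) <= s).
{ intros x Hx; apply Rabs_le_between in Hx.
  destruct (nat_ceil (x / s + INR K)) as [n [Hn1 Hn2]].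
  { assert (- INR K <= x / s) by (apply Rle_div_r; lra). lra. }
  assert (x / s <= INR K) by (apply Rle_div_l; lra).
  assert (E : x = s * (x / s)) by (field; lra).
  assert (Hn : (n <= 2 * K + 1)%nat).
  { apply INR_le; rewrite plus_INR, mult_INR; simpl; lra. }
  exists (n - 1)%nat; assert (n1 : (0 < n)%nat).
  { apply INR_lt; simpl. assert (- INR K <= x / s) by (apply Rle_div_r; lra). lra. }
  split; [lia |]. rewrite minus_INR by lia; simpl.
  rewrite E at 1.
  replace (s * (x / s) - s * (INR n - 1 - INR K)) with (s * (x / s + INR K + 1 - INR n)) by ring.
  rewrite Rabs_mult, (Rabs_pos_eq s) by lra.
  assert (Rabs (x / s + INR K + 1 - INR n) <= 1) by (apply Rabs_le; lra). nra. }
destruct (X (Re c)) as [j [Hj1 Hj2]]; [eapply Rle_trans; [apply re_le_Cmod | auto] |].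
destruct (X (Im c)) as [k [Hk1 Hk2]].
{ eapply Rle_trans; [| exact Hc]; eapply Rle_trans; [apply Rmax_r | apply Rmax_Cmod]. }
exists (s * (INR j - INR K), s * (INR k - INR K)); split.
- apply in_map_iff; exists (j, k); split; auto.
  apply in_prod_iff; split; apply in_seq; lia.
- eapply Rle_trans; [apply Cmod_2Rmax |].
  assert (sqrt 2 <= 2) by (rewrite <- (sqrt_pow2 2) at 2 by lra; apply sqrt_le_1; lra).
  apply Rmult_le_compat; auto using sqrt_pos.
  + eapply Rle_trans; [apply Rabs_pos | apply Rmax_l].
  + apply Rmax_lub; [exact Hj2 | exact Hk2].
Qed.

(** Rounding the first [N] Taylor coefficients to grids of mesh [s] that
    contain the disks of [F_exp_coef_bound] costs [2 s] for each coefficient;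
    the tail is [F_exp_tail].  The logarithm of the number of centres is the
    sum of those of the grid sizes. *)
Lemma covering_upper A B N s eps : 0 < A -> 0 < B -> (0 < N)%nat -> 2 * A <= INR N -> 0 < s ->
  2 * s * INR N + 2 * B * exp (- phi A (INR N)) <= eps ->
  exists l, is_covering bounded_analytic_on_disk Defs.d1 (F_exp A B) eps l /\ (0 < length l)%nat /\
    ln (INR (length l)) <=
    rsum (fun n => 2 * ln (2 * (B * exp A * exp (- phi A (INR n))) / s + 3)) N.
Proof.
intros HA HB HN HN2 Hs Heps.
set (rho := fun n => B * exp A * exp (- phi A (INR n))).
assert (Hrho : forall n, 0 < rho n) by (intros; repeat apply Rmult_lt_0_compat; auto using exp_pos).
assert (HK : forall n, exists K, rho n / s < INR K <= rho n / s + 1).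
{ intros n; apply nat_ceil, Rlt_le, Rdiv_lt_0_compat; auto. }
destruct (choice _ HK) as [K HK']; clear HK.
set (G := fun n => square_grid s (2 * K n + 1) (K n)).
destruct (ln_length_polys G N) as [L1 L2].
{ intros n _; unfold G; rewrite length_square_grid; nia. }
exists (polys G N); split; [split |].
- intros p Hp; apply in_polys in Hp as [b [_ ->]]; apply psum_analytic.
- intros f Hf.
  assert (Hb : forall n, exists c, In c (G n) /\ Cmod (taylor_coef f 1 n - c) <= 2 * s).
  { intros n; apply square_grid_covers; auto.
    eapply Rle_trans; [apply (F_exp_coef_bound A B); auto |]; fold (rho n).
    destruct (HK' n) as [H _]; apply Rlt_div_l in H; auto; lra. }
  destruct (choice _ Hb) as [b Hb']; exists (psum b N); split.
  + apply in_polys; exists b; split; auto; intros; apply Hb'.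
  + apply d1_le; intros z Hz.
    replace (f z - psum b N z)%C with ((f z - psum (taylor_coef f 1) N z) +
       (psum (taylor_coef f 1) N z - psum b N z))%C by ring.
    eapply Rle_trans; [apply Cmod_triangle |].
    assert (H1 := F_exp_tail A B f N z HA HB Hf HN HN2 Hz).
    rewrite psum_minus.
    assert (H2 := psum_norm (fun n => taylor_coef f 1 n - b n)%C N z (2 * s)).
    assert (H3 : Cmod (psum (fun n : nat => (taylor_coef f 1 n - b n)%C) N z) <= INR N * (2 * s))
      by (apply H2; [lra | intros; apply Hb']).
    lra.
- split; auto; rewrite L2; apply rsum_le; intros n _; unfold G; rewrite length_square_grid.
  fold (rho n); destruct (HK' n) as [_ H].
  assert (P : 0 < INR (2 * K n + 1)) by (apply lt_0_INR; lia).
  rewrite mult_INR, ln_mult by auto.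
  assert (ln (INR (2 * K n + 1)) <= ln (2 * rho n / s + 3)); [| lra].
  apply ln_le; auto; rewrite plus_INR, mult_INR; simpl; lra.
Qed.

Lemma Bernoulli_minus d n : 0 <= d <= 1 -> 1 - INR n * d <= (1 - d) ^ n.
Proof.
intros Hd; induction n; [simpl; lra |].
rewrite S_INR; simpl.
assert (P := pos_INR n). assert (0 <= (1 - d) ^ n) by (apply pow_le; lra). nra.
Qed.

(** Cauchy's estimate on the circle of radius [1 - d] loses a factor
    [(1 - d) ^ n], which tends to [1] with [d]. *)
Lemma coef_le_sup_disk b N n e : (n < N)%nat -> (forall z, Cmod z < 1 -> Cmod (psum b N z) <= e) ->
  Cmod (b n) <= e.
Proof.
intros Hn H; apply le_epsilon; intros eta He.
set (M := Cmod (b n)); assert (PM : 0 <= M) by apply Cmod_ge_0; assert (Pn := pos_INR n).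
assert (PK : 0 < (INR n + 1) * (M + 1)) by (apply Rmult_lt_0_compat; lra).
set (d := Rmin (1 / 2) (eta / ((INR n + 1) * (M + 1)))).
assert (Hd : 0 < d) by (apply Rmin_pos; [lra | now apply Rdiv_lt_0_compat]).
assert (Hd1 : d <= 1 / 2) by apply Rmin_l.
assert (Hd2 : d <= eta / ((INR n + 1) * (M + 1))) by apply Rmin_r.
apply Rle_div_r in Hd2; auto.
assert (E := taylor_coef_psum b N (1 - d) n ltac:(lra)).
destruct (lt_dec n N); [| lia].
assert (B := taylor_coef_bound (psum b N) (1 - d) n e ltac:(lra) (holomorphic_psum b N)).
rewrite E in B; fold M in B.
assert (C : M <= e / (1 - d) ^ n).
{ apply B; intros a; apply H; rewrite Cmod_circle; lra. }
apply Rle_div_r in C; [| apply pow_lt; lra].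
assert (Be := Bernoulli_minus d n ltac:(lra)).
assert (M * (1 - INR n * d) <= e) by nra.
assert (0 <= INR n * d) by nra. assert (0 <= M * d) by nra. nra.
Qed.

(** By [exp_phi_optimal] each of the [N] terms uses at most its share
    [1 / N] of the growth bound. *)
Lemma psum_in_F_exp A B b N : 0 < A -> 0 < B ->
  (forall n, (n < N)%nat -> Cmod (b n) <= B / INR N * exp (- phi A (INR n))) -> F_exp A B (psum b N).
Proof.
intros HA HB Hb; split.
- intros z _; destruct (holomorphic_psum b N z) as [l Hl]; exists l; now apply Cdiff_iff.
- intros z; destruct (Nat.eq_dec N 0) as [-> | HN].
  { simpl; rewrite Cmod_0; apply Rmult_le_pos; [lra | apply Rlt_le, exp_pos]. }
  assert (PN : 0 < INR N) by (apply lt_0_INR; lia).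
  assert (X : forall m, (m <= N)%nat -> Cmod (psum b m z) <= INR m * (B / INR N * exp (A * Cmod z))).
  { induction m; intros Hm; [simpl; rewrite Cmod_0; lra |].
    rewrite S_INR, Rmult_plus_distr_r, Rmult_1_l; simpl; eapply Rle_trans; [apply Cmod_triangle |].
    apply Rplus_le_compat; [apply IHm; lia |].
    rewrite Cmod_mult, Cmod_pow.
    eapply Rle_trans; [apply Rmult_le_compat_r; [apply pow_le, Cmod_ge_0 | apply Hb; lia] |].
    rewrite Rmult_assoc; apply Rmult_le_compat_l; [apply Rlt_le, Rdiv_lt_0_compat; auto |].
    apply exp_phi_optimal; auto using Cmod_ge_0. }
  eapply Rle_trans; [apply (X N (Nat.le_refl N)) |]; apply Req_le; field; lra.
Qed.

Lemma F_exp_bounded_on_disk A B f z : 0 < A -> 0 < B -> F_exp A B f -> Cmod z < 1 -> Cmod (f z) <= B * exp A.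
Proof.
intros HA HB [_ H] Hz; eapply Rle_trans; [apply H |].
apply Rmult_le_compat_l; [lra |]; apply exp_le.
rewrite <- (Rmult_1_r A) at 2; apply Rmult_le_compat_l; lra.
Qed.

Lemma square_grid_separated s J c c' : 0 < s -> In c (square_grid s J 0) -> In c' (square_grid s J 0) ->
  c <> c' -> s <= Cmod (c - c').
Proof.
intros Hs H H' N; unfold square_grid in *.
apply in_map_iff in H as [[j k] [<- _]]; apply in_map_iff in H' as [[j' k'] [<- _]]; simpl in *.
assert (X : forall j j', j <> j' -> s <= Rabs (s * (INR j - 0) - s * (INR j' - 0))).
{ clear -Hs; intros j j' N.
  replace (s * (INR j - 0) - s * (INR j' - 0)) with (s * (INR j - INR j')) by ring.
  rewrite Rabs_mult, (Rabs_pos_eq s) by lra.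
  assert (1 <= Rabs (INR j - INR j')); [| nra].
  destruct (Nat.lt_total j j') as [L | [L | L]]; [| lia |]; apply le_INR in L; rewrite S_INR in L.
  - rewrite Rabs_left; lra.
  - rewrite Rabs_pos_eq; lra. }
destruct (Nat.eq_dec j j') as [-> | Nj].
- assert (k <> k') by (intros ->; auto).
  eapply Rle_trans; [apply (X k k'); auto |].
  eapply Rle_trans; [| apply Rmax_Cmod]; apply Rmax_r.
- eapply Rle_trans; [apply (X j j'); auto |].
  eapply Rle_trans; [| apply Rmax_Cmod]; apply Rmax_l.
Qed.

(** A packing argument.  Polynomials with coefficients in grids of mesh
    [3 eps] cannot share a centre: they would be [2 eps] close on the disk, so
    their coefficients would be [2 eps] close by [coef_le_sup_disk], hence
    equal.  The map to centres is therefore injective, and the covering is at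
    least as long as the list of polynomials. *)
Lemma covering_lower A B N eps l : 0 < A -> 0 < B -> 0 < eps -> (0 < N)%nat ->
  is_covering bounded_analytic_on_disk Defs.d1 (F_exp A B) eps l ->
  rsum (fun n => 2 * (ln (B / INR N) - phi A (INR n) - ln (6 * eps))) N <= ln (INR (length l)).
Proof.
intros HA HB He HN [Hl1 Hl2].
assert (PN : 0 < INR N) by (apply lt_0_INR; lia).
set (rho := fun n => B / INR N * exp (- phi A (INR n))).
assert (Hrho : forall n, 0 < rho n) by (intros; apply Rmult_lt_0_compat; auto using exp_pos; now apply Rdiv_lt_0_compat).
assert (HJ : forall n, exists J, rho n / (6 * eps) < INR J <= rho n / (6 * eps) + 1).
{ intros n; apply nat_ceil, Rlt_le, Rdiv_lt_0_compat; auto; lra. }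
destruct (choice _ HJ) as [J HJ']; clear HJ.
assert (PJ : forall n, (0 < J n)%nat).
{ intros n; apply INR_lt; simpl; assert (0 < rho n / (6 * eps)) by (apply Rdiv_lt_0_compat; auto; lra).
  generalize (HJ' n); lra. }
set (G := fun n => square_grid (3 * eps) (J n) 0).
destruct (ln_length_polys G N) as [L1 L2].
{ intros n _; unfold G; rewrite length_square_grid; generalize (PJ n); nia. }
assert (ND : NoDup (polys G N)) by (apply NoDup_polys; intros; apply NoDup_square_grid; lra).
assert (HF : forall b, (forall n, (n < N)%nat -> In (b n) (G n)) -> F_exp A B (psum b N)).
{ intros b Hb; apply psum_in_F_exp; auto; intros n Hn; fold (rho n).
  assert (I := Hb n Hn); unfold G, square_grid in I; apply in_map_iff in I as [[j k] [<- I]].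
  apply in_prod_iff in I as [Ij Ik]; apply in_seq in Ij, Ik; simpl.
  assert (Hj : INR j + 1 <= INR (J n)) by (rewrite <- S_INR; apply le_INR; lia).
  assert (Hk : INR k + 1 <= INR (J n)) by (rewrite <- S_INR; apply le_INR; lia).
  assert (PJ0 := pos_INR j); assert (PK0 := pos_INR k).
  destruct (HJ' n) as [_ H].
  eapply Rle_trans; [apply Cmod_2Rmax |]; simpl.
  assert (S2 : sqrt 2 <= 2) by (rewrite <- (sqrt_pow2 2) at 2 by lra; apply sqrt_le_1; lra).
  assert (D : rho n = 2 * (3 * eps * (rho n / (6 * eps)))) by (field; lra).
  rewrite D; apply Rmult_le_compat; auto using sqrt_pos.
  - eapply Rle_trans; [apply Rabs_pos | apply Rmax_l].
  - apply Rmax_lub; rewrite Rabs_pos_eq by nra; apply Rmult_le_compat_l; lra. }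
assert (Hg : forall p, exists y, In p (polys G N) -> In y l /\ Defs.d1 p y <= eps).
{ intros p; destruct (classic (In p (polys G N))) as [I | I]; [| exists p; tauto].
  assert (Hp : F_exp A B p) by (apply in_polys in I as [b [Hb ->]]; auto).
  destruct (Hl2 p Hp) as [y Hy]; exists y; auto. }
destruct (choice _ Hg) as [g Hg']; clear Hg.
assert (Hinj : NoDup (map g (polys G N))).
{ apply Injective_map_NoDup_in; auto; intros p q Hp Hq E.
  destruct (Hg' p Hp) as [I1 D1]; destruct (Hg' q Hq) as [_ D2]; rewrite <- E in D2.
  apply in_polys in Hp as [b [Hb ->]]; apply in_polys in Hq as [b' [Hb' ->]].
  destruct (Hl1 _ I1) as [_ [M HM]].
  assert (Q : forall n, (n < N)%nat -> Cmod (b n - b' n) <= 2 * eps).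
  { intros n Hn; apply (coef_le_sup_disk (fun n => b n - b' n)%C N n); auto; intros z Hz.
    rewrite <- psum_minus; set (y := g (psum b N)) in *.
    assert (T : forall p, F_exp A B p -> Defs.d1 p y <= eps -> Cmod (p z - y z) <= eps).
    { intros p Hp D; eapply Rle_trans; [| exact D].
      apply (d1_ge p y (B * exp A + M)); auto; intros w Hw.
      unfold Cminus; eapply Rle_trans; [apply Cmod_triangle |]; rewrite Cmod_opp.
      apply Rplus_le_compat; [now apply (F_exp_bounded_on_disk A B) | now apply HM]. }
    assert (T1 := T _ (HF b Hb) D1); assert (T2 := T _ (HF b' Hb') D2).
    replace (psum b N z - psum b' N z)%C with ((psum b N z - y z) + - (psum b' N z - y z))%C by ring.
    eapply Rle_trans; [apply Cmod_triangle |]; rewrite Cmod_opp; lra. }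
  apply functional_extensionality; intros z; apply psum_ext; intros n Hn.
  apply NNPP; intros Nq.
  assert (S := square_grid_separated (3 * eps) (J n) (b n) (b' n) ltac:(lra) (Hb n Hn) (Hb' n Hn) Nq).
  specialize (Q n Hn); lra. }
assert (Hlen : (length (polys G N) <= length l)%nat).
{ rewrite <- (length_map g); apply NoDup_incl_length; auto.
  intros y Hy; apply in_map_iff in Hy as [p [<- Hp]]; now apply Hg'. }
apply Rle_trans with (ln (INR (length (polys G N)))).
- rewrite L2; apply rsum_le; intros n _; unfold G; rewrite length_square_grid.
  destruct (HJ' n) as [H _].
  assert (P0 : 0 < rho n / (6 * eps)) by (apply Rdiv_lt_0_compat; auto; lra).
  rewrite mult_INR, (ln_mult (INR (J n))) by (apply lt_0_INR, PJ).
  assert (K : ln (rho n / (6 * eps)) <= ln (INR (J n))) by (apply ln_le; lra).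
  rewrite ln_div in K by (auto; lra).
  unfold rho in K at 1; rewrite ln_mult, ln_exp in K by (auto using exp_pos; now apply Rdiv_lt_0_compat).
  lra.
- apply ln_le; [apply lt_0_INR; auto | apply le_INR; auto].
Qed.

(** * Comparison of sum and integral *)

(** The antiderivative of [phi]. *)
Definition Phi (A t : R) : R := t ^ 2 / 2 * ln (t / A) - 3 * t ^ 2 / 4.

Lemma is_derive_Phi A t : 0 < A -> 0 < t -> is_derive (Phi A) t (phi A t).
Proof.
intros HA Ht; unfold Phi, phi; assert (0 < t / A) by (now apply Rdiv_lt_0_compat).
auto_derive; [unfold Rdiv in *; auto |]. unfold Rdiv; field; lra.
Qed.

Lemma is_derive_phi A t : 0 < A -> 0 < t -> is_derive (phi A) t (ln (t / A)).
Proof.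
intros HA Ht; unfold phi; assert (0 < t / A) by (now apply Rdiv_lt_0_compat).
auto_derive; [unfold Rdiv in *; auto |]. unfold Rdiv; field; lra.
Qed.

Lemma MVT_pos (F f : R -> R) a b : 0 < a <= b -> (forall t, 0 < t -> is_derive F t (f t)) ->
  exists c, a <= c <= b /\ F b - F a = f c * (b - a).
Proof.
intros H HF; destruct (MVT_gen F a b f) as [c [Hc E]].
- intros x; rewrite Rmin_left, Rmax_right by lra; intros; apply HF; lra.
- intros x; rewrite Rmin_left, Rmax_right by lra; intros.
  apply continuity_pt_filterlim; apply (ex_derive_continuous (V := R_NormedModule)).
  exists (f x); apply HF; lra.
- rewrite Rmin_left, Rmax_right in Hc by lra; eauto.
Qed.

Lemma ln_le_sub_1 y : 0 < y -> ln y <= y - 1.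
Proof. intros Hy; assert (E := exp_ineq1_le (ln y)); rewrite exp_ln in E by auto; lra. Qed.

Lemma ln_nonneg y : 1 <= y -> 0 <= ln y.
Proof. intros; rewrite <- ln_1; apply ln_le; lra. Qed.

(** The mean value theorem for [Phi] and then for [phi], whose derivative
    [ln (t / A)] is logarithmic. *)
Lemma Phi_step A k : 0 < A -> 1 <= k -> Rabs (Phi A (k + 1) - Phi A k - phi A k) <= Rabs (ln A) + ln (k + 1).
Proof.
intros HA Hk.
destruct (MVT_pos (Phi A) (phi A) k (k + 1)) as [c [Hc E]]; [lra | intros; now apply is_derive_Phi |].
destruct (MVT_pos (phi A) (fun t => ln (t / A)) k c) as [d [Hd E']]; [lra | intros; now apply is_derive_phi |].
replace (Phi A (k + 1) - Phi A k - phi A k) with (ln (d / A) * (c - k)) by lra.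
rewrite Rabs_mult, (Rabs_pos_eq (c - k)), ln_div by lra.
assert (L1 := ln_nonneg d ltac:(lra)); assert (L2 : ln d <= ln (k + 1)) by (apply ln_le; lra).
assert (T : Rabs (ln d - ln A) <= Rabs (ln A) + ln (k + 1)).
{ unfold Rminus; eapply Rle_trans; [apply Rabs_triang |]; rewrite Rabs_Ropp, (Rabs_pos_eq (ln d)); lra. }
assert (P := Rabs_pos (ln d - ln A)); nra.
Qed.

(** Comparison of the sum with the integral: each of the [N] steps costs only
    a logarithm, by [Phi_step]. *)
Lemma rsum_phi A N : 0 < A -> (0 < N)%nat ->
  Rabs (rsum (fun n => phi A (INR n)) N - Phi A (INR N)) <=
  Rabs (Phi A 1) + INR N * (Rabs (ln A) + ln (INR N)).
Proof.
intros HA HN; destruct N as [| N]; [lia | clear HN].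
induction N as [| N IH].
- simpl; unfold phi at 1; rewrite Rmult_0_l, Rplus_0_l, Rminus_0_l, Rabs_Ropp, ln_1.
  assert (P := Rabs_pos (ln A)); lra.
- rewrite (S_INR (S N)); set (k := INR (S N)) in *.
  assert (Hk : 1 <= k) by (unfold k; rewrite S_INR; generalize (pos_INR N); lra).
  change (rsum (fun n => phi A (INR n)) (S (S N))) with (rsum (fun n => phi A (INR n)) (S N) + phi A k).
  assert (S := Phi_step A k HA Hk).
  assert (L : ln k <= ln (k + 1)) by (apply ln_le; lra).
  replace (rsum (fun n => phi A (INR n)) (Datatypes.S N) + phi A k - Phi A (k + 1)) with
    ((rsum (fun n => phi A (INR n)) (Datatypes.S N) - Phi A k) + - (Phi A (k + 1) - Phi A k - phi A k)) by ring.
  eapply Rle_trans; [apply Rabs_triang |]; rewrite Rabs_Ropp.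
  assert (k * ln k <= k * ln (k + 1)) by (apply Rmult_le_compat_l; lra). lra.
Qed.

Lemma Phi_shift A x t : 0 < A -> 0 < x -> 0 < t ->
  Phi A t = t ^ 2 / 2 * ln (t / x) + t ^ 2 / 2 * (ln (x / A) - 1) - t ^ 2 / 4.
Proof. intros; unfold Phi; rewrite !ln_div by auto; field. Qed.

(** The left side has derivative [phi A x - phi A t] in [t], so [t = x]
    is a critical point.  With [b = ln (x / A) - 1], the right side minus the left
    one is [b (x - t) ^ 2 / 2 + (x ^ 2 - t ^ 2) / 4 + t ^ 2 ln (t / x) / 2],
    and [ln (t / x) >= 1 - x / t] makes it at least
    [b (x - t) ^ 2 / 2 + (x - t) ^ 2 / 4]. *)
Lemma Legendre_Phi_le A x t : 0 < A -> 0 < x -> 0 < t -> 0 <= ln (x / A) - 1 ->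
  phi A x * t - Phi A t <= x ^ 2 * ((ln (x / A) - 1) / 2 + 1 / 4).
Proof.
intros HA Hx Ht Hb; rewrite (Phi_shift A x t) by auto; unfold phi.
set (b := ln (x / A) - 1) in *.
assert (L : 1 - x / t <= ln (t / x)).
{ assert (H := ln_le_sub_1 (x / t) ltac:(now apply Rdiv_lt_0_compat)).
  rewrite ln_div in H |- * by auto; lra. }
assert (M : t ^ 2 / 2 * (1 - x / t) <= t ^ 2 / 2 * ln (t / x)).
{ apply Rmult_le_compat_l; auto; nra. }
replace (t ^ 2 / 2 * (1 - x / t)) with (t ^ 2 / 2 - x * t / 2) in M by (field; lra).
assert (0 <= b * (x - t) ^ 2) by (apply Rmult_le_pos; auto; apply pow2_ge_0).
assert (0 <= (x - t) ^ 2) by apply pow2_ge_0. lra.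
Qed.

(** Rounding [x] to an integer loses little, because the first order term
    vanishes at the critical point. *)
Lemma Legendre_Phi_ge A x t : 0 < A -> 0 < x -> 0 < t -> x - 1 <= t <= x -> 0 <= ln (x / A) - 1 ->
  x ^ 2 * ((ln (x / A) - 1) / 2 + 1 / 4) - (ln (x / A) - 1) / 2 - x / 2 <= phi A x * t - Phi A t.
Proof.
intros HA Hx Ht Hxt Hb; rewrite (Phi_shift A x t) by auto; unfold phi.
set (b := ln (x / A) - 1) in *.
assert (L : ln (t / x) <= 0).
{ rewrite <- ln_1; apply ln_le; [now apply Rdiv_lt_0_compat |]; apply Rle_div_l; lra. }
assert (M : t ^ 2 / 2 * ln (t / x) <= 0) by (assert (0 <= t ^ 2) by apply pow2_ge_0; nra).
assert (b * (x - t) ^ 2 <= b * 1) by (apply Rmult_le_compat_l; auto; nra).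
assert (x ^ 2 - t ^ 2 <= 2 * x) by nra. lra.
Qed.

(** * Sharp estimates of coverings *)

Lemma ln_scale A b x : 0 < A -> x = A * exp (b + 1) -> 0 < x /\ ln (x / A) - 1 = b /\ ln x = ln A + b + 1.
Proof.
intros HA ->; assert (P := exp_pos (b + 1)); split; [now apply Rmult_lt_0_compat |].
rewrite ln_div, ln_mult, ln_exp by (auto; now apply Rmult_lt_0_compat); lra.
Qed.

(** [covering_upper] with [N] about [x + 1] and mesh [eps / (4 N)].  The main
    term is the integral of [2 (ln (1 / eps) - phi A n)]; everything else
    is [N] times a logarithm of [N]. *)
Lemma log_covering_upper A B : 0 < A -> 0 < B -> exists K b0, 0 <= K /\ 0 <= b0 /\
  forall b x eps, b0 <= b -> 0 < eps -> x = A * exp (b + 1) -> - ln eps = x * b ->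
  exists l, is_covering bounded_analytic_on_disk Defs.d1 (F_exp A B) eps l /\ (0 < length l)%nat /\
    ln (INR (length l)) <= x ^ 2 * (b + 1 / 2) + K * (x * b).
Proof.
intros HA HB.
set (D := Rabs (ln A)); assert (PD : 0 <= D) by apply Rabs_pos.
set (K0 := Rabs (Phi A 1)); assert (PK0 : 0 <= K0) by apply Rabs_pos.
set (c := 8 * B * exp A + 3).
assert (Pc : 3 <= c) by (unfold c; assert (0 < B * exp A) by (apply Rmult_lt_0_compat; auto using exp_pos); lra).
assert (Lc := ln_nonneg c ltac:(lra)).
set (Q := 16 + 3 * D + ln c).
exists (2 * (K0 + 3 * Q)), (1 + D + Rabs (ln (4 * B))).
assert (PB := Rabs_pos (ln (4 * B))).
split; [unfold Q; lra | split; [lra |]].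
intros b x eps Hb He Ex EL.
destruct (ln_scale A b x HA Ex) as [Hx [Eb Elx]].
assert (HAD : - D <= ln A <= D) by (apply Rabs_le_between; unfold D; lra).
assert (Hx1 : 1 <= x).
{ rewrite <- (exp_ln x), <- exp_0 by auto; apply exp_le; lra. }
assert (Hx2 : 2 * A <= x).
{ rewrite Ex, (Rmult_comm 2); apply Rmult_le_compat_l; [lra |].
  generalize (exp_ineq1_le (b + 1)); lra. }
assert (Ephi : phi A x = x * b) by (unfold phi; now rewrite Eb).
(* One index beyond [x] the tail is smaller than [eps] by a factor [exp (- b)],
   which absorbs the constant [4 B]. *)
destruct (nat_ceil (x + 1) ltac:(lra)) as [N [HN1 HN2]].
assert (HN : (0 < N)%nat) by (apply INR_lt; simpl; lra).
assert (LN : ln (INR N) <= (4 + D) * b).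
{ apply Rle_trans with (ln (3 * x)); [apply ln_le; lra |].
  rewrite ln_mult by lra. assert (L3 := ln_le_sub_1 3 ltac:(lra)).
  assert (D <= D * b) by (rewrite <- (Rmult_1_r D) at 1; apply Rmult_le_compat_l; lra). lra. }
assert (LN0 := ln_nonneg (INR N) ltac:(lra)).
destruct (covering_upper A B N (eps / (4 * INR N)) eps) as [l [Hl1 [Hl2 Hl3]]]; auto; try lra.
- apply Rdiv_lt_0_compat; lra.
- replace (2 * (eps / (4 * INR N)) * INR N) with (eps / 2) by (field; lra).
  assert (T : exp (- phi A (INR N)) <= exp (ln eps - b)).
  { apply exp_le; assert ((x + 1) * b <= phi A (INR N)); [| lra].
    unfold phi; apply Rmult_le_compat; try lra.
    assert (ln (x / A) <= ln (INR N / A)); [| lra].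
    apply ln_le; [now apply Rdiv_lt_0_compat |]; apply Rmult_le_compat_r; [| lra].
    apply Rlt_le, Rinv_0_lt_compat; auto. }
  unfold Rminus in T; rewrite exp_plus, exp_ln in T by auto.
  assert (E : exp (- b) * (4 * B) <= 1).
  { rewrite <- (exp_ln (4 * B)) by lra; rewrite <- exp_plus, <- exp_0; apply exp_le.
    assert (H := Rle_abs (ln (4 * B))); lra. }
  assert (B * exp (- phi A (INR N)) <= B * (eps * exp (- b))) by (apply Rmult_le_compat_l; lra).
  assert (eps * (exp (- b) * (4 * B)) <= eps * 1) by (apply Rmult_le_compat_l; lra). lra.
- exists l; split; auto; split; auto.
  (* For the indices between [x] and [N], [phi] may exceed [ln (1 / eps)], but by
     no more than [T]. *)
  set (T := 2 * b + 6).
  assert (Hterm : forall n, (n < N)%nat ->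
     2 * ln (2 * (B * exp A * exp (- phi A (INR n))) / (eps / (4 * INR N)) + 3) <=
     2 * (ln (INR N) + ln c + x * b + T) + -2 * phi A (INR n)).
  { intros n Hn.
    assert (Hphi : phi A (INR n) <= x * b + T).
    { destruct n as [| n]; [unfold phi, T; simpl; rewrite Rmult_0_l;
        assert (0 <= x * b) by (apply Rmult_le_pos; lra); lra |].
      set (k := INR (S n)); assert (Hk : 0 < k) by (apply lt_0_INR; lia).
      assert (Hk2 : k <= x + 2) by (assert (k <= INR N) by (apply le_INR; lia); lra).
      assert (H1 : ln (k / A) - 1 <= b + 2 / x).
      { assert (H := ln_le_sub_1 (k / x) ltac:(now apply Rdiv_lt_0_compat)).
        assert (k / x - 1 <= 2 / x) by (apply Rle_div_r; [lra |];
          replace ((k / x - 1) * x) with (k - x) by (field; lra); lra).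
        rewrite ln_div in H, Eb |- * by auto; lra. }
      assert (H2 : 0 <= b + 2 / x) by (assert (0 < 2 / x) by (apply Rdiv_lt_0_compat; lra); lra).
      unfold phi; apply Rle_trans with (k * (b + 2 / x)); [apply Rmult_le_compat_l; lra |].
      apply Rle_trans with ((x + 2) * (b + 2 / x)); [apply Rmult_le_compat_r; auto |].
      replace ((x + 2) * (b + 2 / x)) with (x * b + (2 * b + 2) + 4 / x) by (field; lra).
      assert (4 / x <= 4) by (apply Rle_div_l; lra). unfold T; lra. }
    assert (E1 : 1 <= exp (x * b - phi A (INR n) + T)) by (rewrite <- exp_0; apply exp_le; lra).
    assert (E2 : exp (- phi A (INR n)) / eps <= exp (x * b - phi A (INR n) + T)).
    { apply Rle_div_l; auto; rewrite <- (exp_ln eps) at 1 by auto; rewrite <- exp_plus.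
      apply exp_le; unfold T; lra. }
    assert (E3 : 2 * (B * exp A * exp (- phi A (INR n))) / (eps / (4 * INR N)) + 3 <=
       INR N * c * exp (x * b - phi A (INR n) + T)).
    { set (w := exp (x * b - phi A (INR n) + T)) in *.
      replace (2 * (B * exp A * exp (- phi A (INR n))) / (eps / (4 * INR N))) with
        (INR N * (8 * B * exp A) * (exp (- phi A (INR n)) / eps)) by (field; lra).
      assert (INR N * (8 * B * exp A) * (exp (- phi A (INR n)) / eps) <= INR N * (8 * B * exp A) * w).
      { apply Rmult_le_compat_l; auto; apply Rmult_le_pos; [lra |]; unfold c in Pc; lra. }
      assert (1 * 1 <= INR N * w) by (apply Rmult_le_compat; lra).
      unfold c; lra. }
    apply ln_le in E3.
    - rewrite !ln_mult, ln_exp in E3; try lra; try apply exp_pos.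
      apply Rmult_lt_0_compat; lra.
    - assert (0 < 2 * (B * exp A * exp (- phi A (INR n))) / (eps / (4 * INR N))); [| lra].
      repeat apply Rmult_lt_0_compat; auto using exp_pos; try lra.
      apply Rinv_0_lt_compat; apply Rdiv_lt_0_compat; lra. }
  eapply Rle_trans; [exact Hl3 |]; eapply Rle_trans; [apply rsum_le, Hterm |].
  rewrite rsum_plus, rsum_const, rsum_scal.
  assert (S := rsum_phi A N HA HN); fold D K0 in S; apply Rabs_le_between in S.
  assert (P := Legendre_Phi_le A x (INR N) HA Hx ltac:(lra) ltac:(lra)); rewrite Ephi, Eb in P.
  assert (R : INR N * (2 * ln (INR N) + ln c + T + D) <= 3 * x * (Q * b)).
  { apply Rmult_le_compat; try lra; [unfold T; lra |].
    assert (D <= D * b) by (rewrite <- (Rmult_1_r D) at 1; apply Rmult_le_compat_l; lra).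
    assert (ln c <= ln c * b) by (rewrite <- (Rmult_1_r (ln c)) at 1; apply Rmult_le_compat_l; lra).
    unfold Q, T; lra. }
  assert (K0 * 1 <= K0 * (x * b)).
  { apply Rmult_le_compat_l; auto; rewrite <- (Rmult_1_r 1); apply Rmult_le_compat; lra. }
  lra.
Qed.

(** [covering_lower] with [N] the integer part of [x]. *)
Lemma log_covering_lower A B : 0 < A -> 0 < B -> exists K b0, 0 <= K /\ 0 <= b0 /\
  forall b x eps l, b0 <= b -> 0 < eps -> x = A * exp (b + 1) -> - ln eps = x * b ->
  is_covering bounded_analytic_on_disk Defs.d1 (F_exp A B) eps l ->
  x ^ 2 * (b + 1 / 2) - K * (x * b) <= ln (INR (length l)).
Proof.
intros HA HB.
set (D := Rabs (ln A)); assert (PD : 0 <= D) by apply Rabs_pos.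
set (K0 := Rabs (Phi A 1)); assert (PK0 : 0 <= K0) by apply Rabs_pos.
set (E := Rabs (ln B)); assert (PE : 0 <= E) by apply Rabs_pos.
set (Q := 13 + 3 * D + E).
exists (2 * (1 + K0 + Q)), (2 + D); split; [unfold Q; lra | split; [lra |]].
intros b x eps l Hb He Ex EL Hl.
destruct (ln_scale A b x HA Ex) as [Hx [Eb Elx]].
assert (HAD : - D <= ln A <= D) by (apply Rabs_le_between; unfold D; lra).
assert (HBE : - E <= ln B <= E) by (apply Rabs_le_between; unfold E; lra).
assert (Hx1 : 2 <= x).
{ assert (X := ln_le_sub_1 x Hx); lra. }
assert (Ephi : phi A x = x * b) by (unfold phi; now rewrite Eb).
destruct (nat_ceil (x - 1) ltac:(lra)) as [N [HN1 HN2]].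
assert (HN : (0 < N)%nat) by (apply INR_lt; simpl; lra).
assert (LN : ln (INR N) <= (2 + D) * b).
{ apply Rle_trans with (ln x); [apply ln_le; lra |].
  assert (D <= D * b) by (rewrite <- (Rmult_1_r D) at 1; apply Rmult_le_compat_l; lra). lra. }
assert (LN0 := ln_nonneg (INR N) ltac:(lra)).
assert (Hlow := covering_lower A B N eps l HA HB He HN Hl).
eapply Rle_trans; [| exact Hlow]; clear Hlow.
assert (Hterm : rsum (fun n => 2 * (ln (B / INR N) - ln (6 * eps)) + -2 * phi A (INR n)) N <=
  rsum (fun n => 2 * (ln (B / INR N) - phi A (INR n) - ln (6 * eps))) N).
{ apply rsum_le; intros; lra. }
eapply Rle_trans; [| exact Hterm].
rewrite rsum_plus, rsum_const, rsum_scal, ln_div, ln_mult by lra.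
assert (S := rsum_phi A N HA HN); fold D K0 in S; apply Rabs_le_between in S.
assert (P := Legendre_Phi_ge A x (INR N) HA Hx ltac:(lra) ltac:(lra) ltac:(lra)); rewrite Ephi, Eb in P.
assert (L6 := ln_le_sub_1 6 ltac:(lra)).
assert (R : INR N * (2 * ln (INR N) + E + 5 + D) <= x * (Q * b)).
{ apply Rmult_le_compat; try lra.
  assert (D <= D * b) by (rewrite <- (Rmult_1_r D) at 1; apply Rmult_le_compat_l; lra).
  assert (E <= E * b) by (rewrite <- (Rmult_1_r E) at 1; apply Rmult_le_compat_l; lra).
  unfold Q; lra. }
assert (K0 * 1 <= K0 * (x * b)).
{ apply Rmult_le_compat_l; auto; rewrite <- (Rmult_1_r 1); apply Rmult_le_compat; lra. }
assert (H1 : INR N * (ln B - ln (INR N) - (ln 6 + ln eps)) >= INR N * (- E - ln (INR N) - 5) + INR N * (x * b)).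
{ rewrite <- Rmult_plus_distr_l; apply Rle_ge, Rmult_le_compat_l; lra. }
assert (b <= x * b) by (rewrite <- (Rmult_1_l b) at 1; apply Rmult_le_compat_r; lra).
assert (x <= x * b) by (rewrite <- (Rmult_1_r x) at 1; apply Rmult_le_compat_l; lra).
lra.
Qed.

(** * From coverings to entropy *)

Lemma ln2_pos : 0 < ln 2.
Proof. rewrite <- ln_1; apply ln_increasing; lra. Qed.

(** Coverings of positive length keep the covering number at least [1], hence
    finite and in the range where the logarithm is monotone. *)
Lemma entropy_le A B eps l :
  is_covering bounded_analytic_on_disk Defs.d1 (F_exp A B) eps l ->
  (forall l, is_covering bounded_analytic_on_disk Defs.d1 (F_exp A B) eps l -> (0 < length l)%nat) ->
  Rbar_le (entropy_F_exp A B eps) (ln (INR (length l)) / ln 2).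
Proof.
intros Hl Hpos; unfold entropy_F_exp, metric_entropy, covering_number.
match goal with |- context [Glb_Rbar ?E] => destruct (Glb_Rbar_correct E) as [G1 G2]; set (g := Glb_Rbar E) in * end.
assert (U := G1 _ (ex_intro _ l (conj Hl eq_refl))).
assert (L : Rbar_le 1 g).
{ apply G2; intros x [l' [Hl' ->]]; simpl; apply (le_INR 1); now apply Hpos. }
destruct g as [g | |]; simpl in *; try tauto.
apply Rmult_le_compat_r; [apply Rlt_le, Rinv_0_lt_compat, ln2_pos |].
apply ln_le; lra.
Qed.

Lemma entropy_ge A B eps v :
  (forall l, is_covering bounded_analytic_on_disk Defs.d1 (F_exp A B) eps l ->
     (0 < length l)%nat /\ v <= ln (INR (length l))) ->
  Rbar_le (v / ln 2) (entropy_F_exp A B eps).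
Proof.
intros H; unfold entropy_F_exp, metric_entropy, covering_number.
match goal with |- context [Glb_Rbar ?E] => destruct (Glb_Rbar_correct E) as [G1 G2]; set (g := Glb_Rbar E) in * end.
assert (L : Rbar_le (exp v) g).
{ apply G2; intros x [l [Hl ->]]; simpl; destruct (H l Hl) as [H1 H2].
  rewrite <- (exp_ln (INR (length l))) by (apply lt_0_INR; auto); now apply exp_le. }
destruct g as [g | |]; simpl in *; try tauto.
apply Rmult_le_compat_r; [apply Rlt_le, Rinv_0_lt_compat, ln2_pos |].
rewrite <- (ln_exp v); apply ln_le; auto using exp_pos.
Qed.

Lemma covering_nonempty A B eps l : 0 < A -> 0 < B ->
  is_covering bounded_analytic_on_disk Defs.d1 (F_exp A B) eps l -> (0 < length l)%nat.
Proof.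
intros HA HB [_ H]; destruct (H (psum (fun _ => 0%C) 0)) as [y [Hy _]].
- apply psum_in_F_exp; auto; lia.
- destruct l; [destruct Hy | simpl; lia].
Qed.

Lemma entropy_nonneg A B eps : 0 < A -> 0 < B -> Rbar_le 0 (entropy_F_exp A B eps).
Proof.
intros HA HB; replace 0 with (0 / ln 2) by (unfold Rdiv; ring); apply entropy_ge.
intros l Hl; assert (H := covering_nonempty A B eps l HA HB Hl); split; auto.
apply ln_nonneg; apply (le_INR 1); auto.
Qed.

Lemma covering_monotone A B eps eps' l : eps <= eps' ->
  is_covering bounded_analytic_on_disk Defs.d1 (F_exp A B) eps l ->
  is_covering bounded_analytic_on_disk Defs.d1 (F_exp A B) eps' l.
Proof.
intros He [H1 H2]; split; auto; intros f Hf; destruct (H2 f Hf) as [y [Hy D]]; exists y; split; auto; lra.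
Qed.

Lemma covering_subclass A A' B eps l : 0 < B -> A' <= A ->
  is_covering bounded_analytic_on_disk Defs.d1 (F_exp A B) eps l ->
  is_covering bounded_analytic_on_disk Defs.d1 (F_exp A' B) eps l.
Proof.
intros HB HA [H1 H2]; split; auto; intros f [Hf1 Hf2]; apply H2; split; auto.
intros z; eapply Rle_trans; [apply Hf2 |]; apply Rmult_le_compat_l; [lra |].
apply exp_le, Rmult_le_compat_r; auto using Cmod_ge_0.
Qed.

(** * The asymptotic parameters *)

Lemma beta_spec A eps : 0 < A -> 0 < eps <= 1 ->
  0 <= beta2 A eps /\ - ln eps = A * exp (beta2 A eps + 1) * beta2 A eps.
Proof.
intros HA He; unfold beta2; set (y := ln (/ eps) / (exp 1 * A)).
assert (Pe := exp_pos 1).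
assert (PA : 0 < exp 1 * A) by (now apply Rmult_lt_0_compat).
assert (L : ln (/ eps) = - ln eps) by (apply ln_Rinv; lra).
assert (Hl : 0 <= ln (/ eps)).
{ apply ln_nonneg; rewrite <- Rinv_1; apply Rinv_le_contravar; lra. }
assert (Hy : 0 <= y) by (apply Rmult_le_pos; auto; apply Rlt_le, Rinv_0_lt_compat; auto).
assert (W := lambertW_spec y Hy); set (w := lambertW y) in *.
assert (Pw := exp_pos w); split; [nra |].
rewrite exp_plus; replace (A * (exp w * exp 1) * w) with (exp 1 * A * (w * exp w)) by ring.
rewrite W, <- L; unfold y; field; lra.
Qed.

Lemma beta_large A b0 : 0 < A -> 0 <= b0 -> exists d, 0 < d /\
  forall eps, 0 < eps <= 1 -> eps < d -> b0 <= beta2 A eps.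
Proof.
intros HA Hb; exists (exp (- (A * exp (b0 + 1) * b0))); split; [apply exp_pos |].
intros eps He Hd; destruct (beta_spec A eps HA He) as [B1 B2].
apply Rnot_lt_le; intros Hlt; set (b := beta2 A eps) in *.
apply ln_increasing in Hd; [| lra]; rewrite ln_exp in Hd.
assert (exp (b + 1) <= exp (b0 + 1)) by (apply exp_le; lra).
assert (P := exp_pos (b + 1)).
assert (A * exp (b + 1) * b <= A * exp (b0 + 1) * b0).
{ apply Rmult_le_compat; auto; try lra; [apply Rmult_le_pos; lra | apply Rmult_le_compat_l; lra]. }
lra.
Qed.

(** With [x = A exp (b + 1)] the bound of the theorem is
    [x ^ 2 (b + 1 / 2) / ln 2]. *)
Lemma main_term A eps : 
  (exp 1 * A) ^ 2 * (exp (2 * beta2 A eps) / ln 2) * (beta2 A eps + 1 / 2) =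
  (A * exp (beta2 A eps + 1)) ^ 2 * (beta2 A eps + 1 / 2) / ln 2.
Proof.
replace (2 * beta2 A eps) with (beta2 A eps + beta2 A eps) by ring; rewrite !exp_plus; field.
apply Rgt_not_eq, ln2_pos.
Qed.

(** An error [K x b] is a relative error [O (exp (- b))], since [x] is a
    multiple of [exp b]. *)
Lemma error_term A K b : 0 < A -> 0 <= K -> 0 <= b ->
  K * (A * exp (b + 1) * b) <= (A * exp (b + 1)) ^ 2 * (b + 1 / 2) * (K / (exp 1 * A) * exp (- b)).
Proof.
intros HA HK Hb; assert (P1 := exp_pos 1); assert (Pb := exp_pos b).
rewrite exp_plus, exp_Ropp.
replace ((A * (exp b * exp 1)) ^ 2 * (b + 1 / 2) * (K / (exp 1 * A) * / exp b)) with
  (K * (A * (exp b * exp 1) * (b + 1 / 2))) by (field; lra).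
apply Rmult_le_compat_l; auto; apply Rmult_le_compat_l; [| lra].
repeat apply Rmult_le_pos; lra.
Qed.

Lemma big_O_intro A K b0 r : 0 < A -> 0 <= K -> 0 <= b0 ->
  (forall eps, 0 < eps <= 1 -> b0 <= beta2 A eps -> Rabs (r eps) <= K * exp (- beta2 A eps)) ->
  big_O_at_0 r (fun eps => exp (- beta2 A eps)).
Proof.
intros HA HK Hb H; destruct (beta_large A b0 HA Hb) as [d [Hd1 Hd2]]; exists K.
assert (Hm : 0 < Rmin d 1) by (apply Rmin_pos; lra).
exists (mkposreal _ Hm); intros eps Be Pe.
assert (X : Rabs (eps - 0) < Rmin d 1) by exact Be.
rewrite Rminus_0_r, Rabs_pos_eq in X by lra; apply Rmin_Rgt in X as [X1 X2].
apply H; [lra | apply Hd2; lra].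
Qed.

(** The lower bound of the theorem is the sharp one for the exponential type
    [A / 2]. *)
Lemma beta1_half A eps : beta1 A eps = beta2 (A / 2) eps.
Proof.
unfold beta1, beta2; f_equal; assert (P := exp_pos 1).
destruct (Req_dec A 0) as [-> | HA]; [unfold Rdiv; rewrite !Rmult_0_l, !Rmult_0_r, Rinv_0; ring |].
field; lra.
Qed.

Theorem theorem18 (A B : R) (hA : 0 < A) (hB : 0 < B) :
  (exists r1 : R -> R,
      big_O_at_0 r1 (fun eps => exp (- beta1 A eps)) /\
      forall eps : R, 0 < eps <= 1 ->
        Rbar_le
          (Finite ((exp 1 * A / 2) ^ 2 * (exp (2 * beta1 A eps) / ln 2)
                   * (beta1 A eps + 1 / 2) * (1 + r1 eps)))
          (entropy_F_exp A B eps)) /\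
  (exists r2 : R -> R,
      big_O_at_0 r2 (fun eps => exp (- beta2 A eps)) /\
      forall eps : R, 0 < eps <= 1 ->
        Rbar_le
          (entropy_F_exp A B eps)
          (Finite ((exp 1 * A) ^ 2 * (exp (2 * beta2 A eps) / ln 2)
                   * (beta2 A eps + 1 / 2) * (1 + r2 eps)))).
Proof.
assert (L2 := ln2_pos); split.
- assert (hA2 : 0 < A / 2) by lra.
  destruct (log_covering_lower (A / 2) B hA2 hB) as [K [b0 [HK [Hb0 H]]]].
  assert (PK : 0 <= K / (exp 1 * (A / 2))).
  { apply Rmult_le_pos; auto; apply Rlt_le, Rinv_0_lt_compat, Rmult_lt_0_compat; auto using exp_pos. }
  set (M := K / (exp 1 * (A / 2))) in *.
  (* The value [-1] makes the lower bound zero when [eps] is not small. *)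
  exists (fun eps => if Rle_dec b0 (beta1 A eps) then - (M * exp (- beta1 A eps)) else -1); split.
  + replace (fun eps => exp (- beta1 A eps)) with (fun eps => exp (- beta2 (A / 2) eps))
      by (apply functional_extensionality; intros; now rewrite beta1_half).
    apply (big_O_intro (A / 2) M b0); auto; intros eps He Hb; rewrite beta1_half.
    destruct (Rle_dec b0 (beta2 (A / 2) eps)); [| tauto].
    rewrite Rabs_Ropp, Rabs_pos_eq; [lra |]; apply Rmult_le_pos; auto; apply Rlt_le, exp_pos.
  + intros eps He; rewrite !beta1_half.
    destruct (beta_spec (A / 2) eps hA2 He) as [B1 B2].
    replace (exp 1 * A / 2) with (exp 1 * (A / 2)) by field.
    rewrite main_term; set (b := beta2 (A / 2) eps) in *; set (x := A / 2 * exp (b + 1)) in *.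
    destruct (Rle_dec b0 b) as [Hb | Hb].
    * replace (x ^ 2 * (b + 1 / 2) / ln 2 * (1 + - (M * exp (- b)))) with
        ((x ^ 2 * (b + 1 / 2) - x ^ 2 * (b + 1 / 2) * (M * exp (- b))) / ln 2) by (field; lra).
      apply entropy_ge; intros l Hl; split; [now apply (covering_nonempty A B eps) |].
      assert (Hl' : is_covering bounded_analytic_on_disk Defs.d1 (F_exp (A / 2) B) eps l)
        by (apply (covering_subclass A); auto; lra).
      assert (E := error_term (A / 2) K b hA2 HK B1); fold x in E; fold M in E.
      assert (G := H b x eps l Hb ltac:(lra) eq_refl B2 Hl'). lra.
    * replace (x ^ 2 * (b + 1 / 2) / ln 2 * (1 + -1)) with 0 by ring.
      now apply entropy_nonneg.
- destruct (log_covering_upper A B hA hB) as [K [b0 [HK [Hb0 H]]]].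
  assert (PK : 0 <= K / (exp 1 * A)).
  { apply Rmult_le_pos; auto; apply Rlt_le, Rinv_0_lt_compat, Rmult_lt_0_compat; auto using exp_pos. }
  set (M := K / (exp 1 * A)) in *.
  assert (Hne : forall eps l, is_covering bounded_analytic_on_disk Defs.d1 (F_exp A B) eps l -> (0 < length l)%nat)
    by (intros eps l; now apply covering_nonempty).
  set (main := fun eps => (A * exp (beta2 A eps + 1)) ^ 2 * (beta2 A eps + 1 / 2) / ln 2).
  (* When [eps] is not small the error term is chosen to give equality. *)
  exists (fun eps => if Rle_dec b0 (beta2 A eps) then M * exp (- beta2 A eps)
    else real (entropy_F_exp A B eps) / main eps - 1); split.
  + apply (big_O_intro A M b0); auto; intros eps He Hb.
    destruct (Rle_dec b0 (beta2 A eps)); [| tauto].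
    rewrite Rabs_pos_eq; [lra |]; apply Rmult_le_pos; auto; apply Rlt_le, exp_pos.
  + intros eps He; rewrite main_term; fold (main eps).
    destruct (beta_spec A eps hA He) as [B1 B2].
    destruct (Rle_dec b0 (beta2 A eps)) as [Hb | Hb].
    * destruct (H _ _ eps Hb ltac:(lra) eq_refl B2) as [l [Hl1 [Hl2 Hl3]]].
      eapply Rbar_le_trans; [apply (entropy_le A B eps l); eauto |]; simpl.
      assert (E := error_term A K _ hA HK B1); fold M in E; unfold main.
      set (b := beta2 A eps) in *; set (x := A * exp (b + 1)) in *.
      replace (x ^ 2 * (b + 1 / 2) / ln 2 * (1 + M * exp (- b))) with
        ((x ^ 2 * (b + 1 / 2) + x ^ 2 * (b + 1 / 2) * (M * exp (- b))) / ln 2) by (field; lra).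
      apply Rmult_le_compat_r; [apply Rlt_le, Rinv_0_lt_compat; auto | lra].
    * (* The entropy is finite, as a covering for a smaller radius serves. *)
      destruct (beta_large A b0 hA Hb0) as [d [Hd1 Hd2]].
      assert (Hm : 0 < Rmin eps (d / 2)) by (apply Rmin_pos; lra).
      assert (Hm1 := Rmin_l eps (d / 2)); assert (Hm2 := Rmin_r eps (d / 2)).
      set (eps' := Rmin eps (d / 2)) in *.
      assert (He' : 0 < eps' <= 1) by lra.
      destruct (beta_spec A eps' hA He') as [_ B2'].
      destruct (H _ _ eps' (Hd2 eps' He' ltac:(lra)) Hm eq_refl B2') as [l [Hl1 _]].
      assert (U := entropy_le A B eps l (covering_monotone A B _ _ l Hm1 Hl1) (Hne eps)).
      assert (V := entropy_nonneg A B eps hA hB).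
      assert (Pm : 0 < main eps).
      { unfold main; repeat apply Rmult_lt_0_compat; auto using exp_pos; try lra.
        now apply Rinv_0_lt_compat. }
      destruct (entropy_F_exp A B eps) as [h | |]; simpl in *; try tauto.
      apply Req_le; field; lra.
Qed.
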